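(* (Christoffel–Darboux formula.) Suppose that $a\neq 0$. Then $$\bar\partial_\eta \widetilde{\mathbf K}_n^c(\zeta,\eta)= e^{-N\zeta\bar\eta}\,\frac{1}{\frac{n+c}{N}h_{n-1}-h_n}\;\bar\partial_\eta\overline{\psi_n(\eta)}\,\Big(\psi_n(\zeta)-\zeta\psi_{n-1}(\zeta)\Big)\;-\;e^{-N\zeta\bar\eta}\,\frac{P_{n+1}(a)}{P_n(a)}\,\frac{N\,h_n/h_{n-1}}{\frac{n+c+1}{N}h_n-h_{n+1}}\;\overline{\psi_{n-1}(\eta)}\,\Big(\psi_{n+1}(\zeta)-\zeta\psi_n(\zeta)\Big).$$
   Context: Here $a\ge 0$, $c>-1$, and $N,n\ge1$ are integers. $dA(\zeta)=d^2\zeta/\pi$ is Lebesgue measure on $\mathbb C$ divided by $\pi$, and $\bar\partial_\eta=\partial/\partial\bar\eta$ is the Wirtinger derivative. $P_j$ ($j\ge0$) is the monic orthogonal polynomial of degree $j$ satisfying $$\int_{\mathbb C}P_j(\zeta)\overline{P_k(\zeta)}\,|\zeta-a|^{2c}e^{-N|\zeta|^2}\,dA(\zeta)=h_j\,\delta_{jk},$$ where $h_j$ is the orthogonal norm (so $P_j$ and $h_j$ depend on $N,a,c$). With $(\zeta-a)^c$ a fixed holomorphic branch (for $\zeta,\eta$ in its domain), set $$\psi_j(\zeta)=(\zeta-a)^cP_j(\zeta),\qquad \phi_j(\zeta)=(\zeta-a)^c\frac{P_j(\zeta)}{h_j},\qquad \widetilde{\mathbf K}_n^c(\zeta,\eta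)=e^{-N\zeta\bar\eta}\sum_{j=0}^{n-1}\overline{\phi_j(\eta)}\,\psi_j(\zeta).$$
   Formalization: The case c = 0 is excluded: there P_j(ζ) = ζ^j and h_j = j!/N^{j+1}, so both denominators (n+c)/N·h_{n-1} − h_n and (n+c+1)/N·h_n − h_{n+1} vanish and the formula is undefined. *)

(* Defs.v *)
From HB Require Import structures.
From mathcomp Require Import all_boot all_order all_algebra.
From mathcomp Require Import all_classical all_reals all_analysis.
From mathcomp Require Import complex.

Set Implicit Arguments.
Unset Strict Implicit.
Unset Printing Implicit Defensive.

Import Order.TTheory GRing.Theory Num.Theory.
Import numFieldNormedType.Exports.

Local Open Scope ring_scope.
Local Open Scope complex_scope.

Section Defs.
Variable R : realType.
Implicit Types (z zeta eta : R[i]) (f : R[i] -> R[i]).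

Definition cexp z : R[i] :=
  (expR (complex.Re z))%:C * (cos (complex.Im z) +i* sin (complex.Im z)).

(* [integral_dA f] is the integral of f with respect to dA = dx dy / pi. *)
Definition integral_dA f : R[i] :=
  let mu := ((@lebesgue_measure R) \x (@lebesgue_measure R))%E in
  (pi^-1)%:C *
    ((\int[mu]_p complex.Re (f (p.1 +i* p.2)))
     +i* (\int[mu]_p complex.Im (f (p.1 +i* p.2)))).

(* Partial derivatives in the real coordinates x + i y, taken separately on
   the real and imaginary parts of f. *)
Definition partial_x f z : R[i] :=
  derive1 (fun x : R => complex.Re (f (x +i* complex.Im z))) (complex.Re z)
  +i* derive1 (fun x : R => complex.Im (f (x +i* complex.Im z))) (complex.Re z).

Definition partial_y f z : R[i] :=
  derive1 (fun y : R => complex.Re (f (complex.Re z +i* y))) (complex.Im z)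
  +i* derive1 (fun y : R => complex.Im (f (complex.Re z +i* y))) (complex.Im z).

Definition dbar f z : R[i] := 2^-1 * (partial_x f z + 'i%C * partial_y f z).

(* [`|z - a|] is real but typed in R[i], hence the projection to R. *)
Definition weight (N : nat) (a c : R) z : R :=
  (complex.Re `|z - a%:C|) `^ (2 * c)
  * expR (- (N%:R * (complex.Re `|z|) ^+ 2)).

Definition monic_orthogonal (N : nat) (a c : R)
    (P : nat -> {poly R[i]}) (h : nat -> R) : Prop :=
  (forall j, P j \is monic /\ size (P j) = j.+1) /\
  (forall j k, integral_dA (fun z =>
       (P j).[z] * conjc (P k).[z] * (weight N a c z)%:C)
     = if j == k then (h j)%:C else 0).

(* b is a holomorphic branch of z |-> (z - a)^c on the open set D: complex
   differentiable on D, each value being exp (c l) for some logarithm l of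
   z - a (which forces a \notin D). *)
Definition power_branch (D : set R[i]^o) (a c : R) (b : R[i] -> R[i]) : Prop :=
  open D /\
  forall z, D z ->
    derivable (b : R[i]^o -> R[i]^o) z 1 /\
    exists l : R[i], cexp l = z - a%:C /\ b z = cexp (c%:C * l).

Definition psi (b : R[i] -> R[i]) (P : nat -> {poly R[i]}) (j : nat) z : R[i] :=
  b z * (P j).[z].

Definition phi (b : R[i] -> R[i]) (P : nat -> {poly R[i]}) (h : nat -> R)
    (j : nat) z : R[i] :=
  b z * ((P j).[z] / (h j)%:C).

Definition kernel_tilde (N : nat) (b : R[i] -> R[i]) (P : nat -> {poly R[i]})
    (h : nat -> R) (n : nat) zeta eta : R[i] :=
  cexp (- (N%:R * (zeta * conjc eta)))
  * \sum_(j < n) conjc (phi b P h j eta) * psi b P j zeta.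

End Defs.

(* Main.v *)
Require Import Defs.
From HB Require Import structures.
From mathcomp Require Import all_boot all_order all_algebra.
From mathcomp Require Import all_classical all_reals all_analysis.
From mathcomp Require Import measurable_realfun.
From mathcomp Require Import complex.
From mathcomp Require Import ring lra.

Set Implicit Arguments.
Unset Strict Implicit.
Unset Printing Implicit Defensive.

Import Order.TTheory GRing.Theory Num.Theory.
Import numFieldNormedType.Exports.

Local Open Scope ring_scope.
Local Open Scope complex_scope.

(** Why the formula holds.

Write u = X - a.  Integration by parts against |z - a|^(2c) exp(-N|z|^2) gives
  N <X p, u g> = <p, u g' + (1 + c) g>                                  (1)
for polynomials p and g ([form_ibp]): the Gaussian removes the boundary terms
at infinity and the factor u removes the singularity at a.  The imaginary part
of the pairing of two real polynomials is antisymmetric and satisfies (1) too,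
and only the zero form does both ([antisym_form_eq0]).  So all moments are
real, every P_j has real coefficients ([P_real]), and what remains is algebra
with a real positive definite form B that satisfies (1).

Let K_n be the sum of P_j(a) / h_j P_j over j < n, that is the polynomial of
degree less than n that represents evaluation at a.  By (1), P_(n+1) - X P_n
is orthogonal to every multiple of u of degree at most n, hence equals
t_n K_(n+1) for a scalar t_n ([Q_step]).  Two more pairings give
  (n+1+c)/N h_n - h_(n+1) = t_n P_(n+1)(a)                              (2)
([h_step]) and express u P_(n+1)' through P_(n+1), K_(n+1) and P_n
([Q_deriv]).  Thus both denominators of the formula have the form (2) and
cancel against the factors P_(k+1) - X P_k = t_k K_(k+1).  The cancelled
formula is [christoffel_darboux], proved by induction on n; the induction step
rests on a three-term relation for the operator u d/dX + c, [euler_op_step].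

Dividing by (2) needs P_n(a) and t_n to be nonzero.

For P_n(a): with the weight centred at a, |z - a|^(2c) exp(-N|z - a|^2),
integration by parts makes u d/dX symmetric; it is nonnegative by induction on
the degree.  Multiplication by exp(-aN(z - a)) carries one weight to the other,
so u d/dX - aN u is nonnegative for B; as the exponential is no polynomial, it
is approached by powers of 1 - aN u / m ([form_number]).  Feeding this operator
the solution s of u (s' - aN s) = P_n(a) P_(n+1) - P_(n+1)(a) P_n gives
P_n(a) P_(n+1)(a) > 0 ([val_at_gt0]).

For t_n: evaluating the formula for u P_(n+1)' at a gives a recursion for t_n.
If c t_n <= 0 for one n, the recursion keeps that sign for ever and makes |t_n|
grow like a factorial, which (2), the value of [Q_step] at a and the positivity
of h_n and P_n(a) do not allow ([step_coef_neq0]).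

On the analytic side, the kernel is a finite sum, so its conjugate derivative
is taken term by term ([dbar_kernel_tilde]).  The only fact needed about the
branch b of (z - a)^c is (z - a) b' = c b, and this follows from b being
holomorphic with |b|^2 = |z - a|^(2c) ([branch_deriv]). *)

(** * Division by X - a and factorial growth *)

Section MonicRemainder.
Variable R : idomainType.

Lemma size_sub_lead (m : nat) (q r : {poly R}) :
  r \is monic -> size r = m.+1 -> (size q <= m.+1)%N ->
  (size (q - q`_m *: r)%R <= m)%N.
Proof.
move=> rm sr sq; apply/leq_sizeP => j; rewrite leq_eqVlt => /orP[/eqP <-|lmj].
  rewrite coefB coefZ; move: rm; rewrite monicE lead_coefE sr /= => /eqP ->.
  by rewrite mulr1 subrr.
rewrite coefB coefZ [q`_j]nth_default ?[r`_j]nth_default ?sr ?mulr0 ?subrr//.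
exact: leq_trans sq lmj.
Qed.

Lemma poly_XsubC_decomp (a : R) (q : {poly R}) :
  exists g, q = ('X - a%:P) * g + (q.[a])%:P.
Proof.
have /factor_theorem[g hg] : root (q - (q.[a])%:P) a.
  by rewrite rootE !hornerE subrr.
by exists g; rewrite mulrC -hg subrK.
Qed.

Lemma size_XsubC_mul_le (a : R) (g : {poly R}) m :
  (size (('X - a%:P) * g)%R <= m.+1)%N -> (size g <= m)%N.
Proof.
have [->|g0] := eqVneq g 0; first by rewrite mulr0 size_poly0.
by rewrite mulrC size_Mmonic ?monicXsubC// size_XsubC addn2.
Qed.

Lemma coef_XsubC_mul (a : R) (g : {poly R}) m :
  (size g <= m.+1)%N -> (('X - a%:P) * g)`_m.+1 = g`_m.
Proof.
move=> sg; rewrite mulrBl coefB coefXM/= coefCM (nth_default 0 sg).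
by rewrite mulr0 subr0.
Qed.

Lemma coef_XsubC_deriv (a : R) (g : {poly R}) m :
  (size g <= m.+1)%N -> (('X - a%:P) * g^`())`_m = m%:R * g`_m.
Proof.
move=> sg; rewrite mulrBl coefB coefCM coefXM [_^`()`_m]coef_deriv.
rewrite (nth_default 0 sg) mul0rn mulr0 subr0.
by case: m sg => [|m] sg /=; rewrite ?mul0r// coef_deriv mulr_natl.
Qed.

Lemma size_XsubC_deriv (a : R) (g : {poly R}) m :
  (size g <= m.+1)%N -> (size (('X - a%:P) * g^`())%R <= m.+1)%N.
Proof.
move=> sg; have [->|g0] := eqVneq g^`() 0; first by rewrite mulr0 size_poly0.
rewrite mulrC size_Mmonic ?monicXsubC// size_XsubC addn2/=.
have /leq_sizeP hg := sg; rewrite ltnS; apply/leq_sizeP => j lj; rewrite coef_deriv hg ?mul0rn//.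
Qed.

End MonicRemainder.

(** From the index where k (m + 1) passes 2 on, the sequence doubles at each step,
so it already outgrows the linear sequence and passes every bound. *)
Lemma unbounded_factorial_growth (R : archiRealFieldType) (k C : R) (x : nat -> R) (M : nat) :
  0 < k -> (forall m, (M <= m)%N -> 0 < x m) ->
  (forall m, (M <= m)%N -> k * m.+1%:R * x m <= x m.+1) ->
  (forall m, (M <= m)%N -> x m <= C) -> False.
Proof.
move=> k0 x0 xS xC.
pose M' := (M + (Num.truncn (2 / k)).+1)%N.
have kM m : (M' <= m)%N -> 2 <= k * m.+1%:R.
  move=> lm; rewrite mulrC -ler_pdivrMr//.
  apply: ltW (lt_le_trans (truncnS_gt _) _); rewrite ler_nat.
  exact: leq_trans (leq_addl M _) (leqW lm).
have MM' m : (M <= M' + m)%N by rewrite /M' -addnA leq_addr.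
have xM : 0 < x M' by have := MM' 0%N; rewrite addn0 => /x0.
have grow m : (m.+1)%:R * x M' <= x (M' + m)%N.
  elim: m => [|m IH]; first by rewrite mul1r addn0.
  rewrite addnS; apply: le_trans (xS _ (MM' _)).
  have h1 := kM (M' + m)%N (leq_addr _ _).
  have h2 : 2 * x (M' + m)%N <= k * (M' + m).+1%:R * x (M' + m)%N.
    by rewrite ler_wpM2r// ltW// x0// MM'.
  apply: le_trans h2; apply: (@le_trans _ _ (2 * (m.+1%:R * x M'))); last first.
    by rewrite ler_wpM2l.
  rewrite mulrA ler_wpM2r ?(ltW xM)//.
  by rewrite -natrM ler_nat mul2n -addnn addSn ltnS leq_addl.
have := truncnS_gt (C / x M'); rewrite ltr_pdivrMr//.
by rewrite ltNge (le_trans (grow _))// xC.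
Qed.

(** * Orthogonal polynomials of a form with the integration by parts rule *)

Section OrthogonalPolynomials.
Variables (R : archiRealFieldType) (a c nu : R).
Hypotheses (a_gt0 : 0 < a) (c_gt : -1 < c) (nu_gt0 : 0 < nu).
Variable B : {poly R} -> {poly R} -> R.
Hypothesis B_linear : forall k p q r, B (k *: p + q) r = k * B p r + B q r.
Hypothesis B_sym : forall p q, B p q = B q p.
Hypothesis B_gt0 : forall p, p != 0 -> 0 < B p p.
(** The only trace left by the weight: its integration by parts rule. *)
Hypothesis B_ibp : forall p g,
  nu * B ('X * p) (('X - a%:P) * g) = B p (('X - a%:P) * g^`() + (1 + c) *: g).
(** By [B_ibp] this is nonnegativity of the operator (X - a) d/dX - a nu (X - a),
see [numberE]. *)
Hypothesis B_number : forall p,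
  (1 + c) * B p p <= nu * B (('X - a%:P) * p) (('X - a%:P) * p).
Variables (Q : nat -> {poly R}) (h : nat -> R).
Hypothesis Q_monic : forall n, Q n \is monic.
Hypothesis size_Q : forall n, size (Q n) = n.+1.
Hypothesis Q_orth : forall j k, B (Q j) (Q k) = if j == k then h j else 0.

Let u : {poly R} := 'X - a%:P.

Lemma B0l r : B 0 r = 0.
Proof. by have := B_linear 1 0 0 r; rewrite scaler0 addr0 mul1r; lra. Qed.
Lemma BDl p q r : B (p + q) r = B p r + B q r.
Proof. by rewrite -[p]scale1r B_linear mul1r scale1r. Qed.
Lemma BZl k p r : B (k *: p) r = k * B p r.
Proof. by rewrite -[k *: p]addr0 B_linear B0l addr0. Qed.
Lemma BNl p r : B (- p) r = - B p r.
Proof. by rewrite -scaleN1r BZl mulN1r. Qed.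
Lemma BDr p q r : B r (p + q) = B r p + B r q.
Proof. by rewrite B_sym BDl !(B_sym r). Qed.
Lemma BZr k p r : B r (k *: p) = k * B r p.
Proof. by rewrite B_sym BZl (B_sym r). Qed.
Lemma BNr p r : B r (- p) = - B r p.
Proof. by rewrite B_sym BNl (B_sym r). Qed.
Lemma B0r r : B r 0 = 0. Proof. by rewrite B_sym B0l. Qed.

Definition BE := (BDl, BNl, BZl, BDr, BNr, BZr, B0l, B0r).

Lemma Q_neq0 n : Q n != 0. Proof. exact: monic_neq0. Qed.
Lemma h_gt0 n : 0 < h n.
Proof. by have := B_gt0 (Q_neq0 n); rewrite Q_orth eqxx. Qed.
Lemma Q_lead n : (Q n)`_n = 1.
Proof. by have := Q_monic n; rewrite monicE lead_coefE size_Q => /eqP. Qed.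
Lemma Q0_eq1 : Q 0 = 1.
Proof.
have /eqP /size_poly1P [k k0 e] := size_Q 0.
by have := Q_lead 0; rewrite e coefC/= => ->.
Qed.

Lemma Q_orth_lt m n (q : {poly R}) : (m <= n)%N -> (size q <= m)%N -> B (Q n) q = 0.
Proof.
elim: m q => [|m IH] q mn sq.
  by move: sq; rewrite leqn0 size_poly_eq0 => /eqP ->; rewrite B0r.
rewrite -(subrK (q`_m *: Q m) q) BDr BZr Q_orth gtn_eqF// mulr0 addr0.
by apply: IH (ltnW mn) _; apply: size_sub_lead.
Qed.

Lemma B_Q n (q : {poly R}) : (size q <= n.+1)%N -> B (Q n) q = q`_n * h n.
Proof.
move=> sq; rewrite -{1}(subrK (q`_n *: Q n) q) BDr BZr Q_orth eqxx.
by rewrite (Q_orth_lt (leqnn n)) ?add0r//; apply: size_sub_lead.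
Qed.

Lemma B_eq0 n (p : {poly R}) : (size p <= n)%N ->
  (forall q : {poly R}, (size q <= n)%N -> B p q = 0) -> p = 0.
Proof.
move=> sp H; apply/eqP/negP => /negP p0.
by have := B_gt0 p0; rewrite H// ltxx.
Qed.

Definition val_at n := (Q n).[a].
(** Among polynomials of degree less than n, the representative of evaluation
at a, see [B_kernel_at]. *)
Definition kernel_at n : {poly R} := \sum_(j < n) (val_at j / h j) *: Q j.
Definition kernel_diag n := (kernel_at n).[a].
(** The scalar t_n for which Q_(n+1) - X Q_n = t_n K_(n+1), see [Q_step]. *)
Definition step_coef n := - B ('X * Q n) 1.

Lemma kernel_atS n : kernel_at n.+1 = kernel_at n + (val_at n / h n) *: Q n.
Proof. by rewrite /kernel_at big_ord_recr. Qed.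
Lemma kernel_at0 : kernel_at 0 = 0. Proof. by rewrite /kernel_at big_ord0. Qed.
Lemma size_kernel_at n : (size (kernel_at n) <= n)%N.
Proof.
elim: n => [|n IH]; first by rewrite kernel_at0 size_poly0.
rewrite kernel_atS (leq_trans (size_polyD _ _))// geq_max (leq_trans IH)//=.
by rewrite (leq_trans (size_scale_leq _ _))// size_Q.
Qed.

Lemma B_kernel_at n (q : {poly R}) : (size q <= n)%N -> B (kernel_at n) q = q.[a].
Proof.
elim: n q => [|n IH] q sq.
  by move: sq; rewrite leqn0 size_poly_eq0 => /eqP ->; rewrite B0r horner0.
have [r sr ->] : exists2 r : {poly R}, (size r <= n)%N & q = r + q`_n *: Q n.
  by exists (q - q`_n *: Q n); rewrite ?subrK// size_sub_lead.
rewrite kernel_atS BDl !BDr !BZl !BZr IH// (Q_orth_lt (leqnn n) sr) Q_orth eqxx.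
rewrite hornerD hornerZ (B_sym (kernel_at n)) (Q_orth_lt (leqnn n) (size_kernel_at n)).
by have := h_gt0 n => hn; rewrite /val_at; field; rewrite gt_eqF.
Qed.

Lemma kernel_diagS n : kernel_diag n.+1 = kernel_diag n + val_at n ^+ 2 / h n.
Proof. by rewrite /kernel_diag kernel_atS hornerD hornerZ -/(val_at n) expr2 mulrAC. Qed.
Lemma kernel_diag_gt0 n : 0 < kernel_diag n.+1.
Proof.
elim: n => [|n IH]; rewrite kernel_diagS.
  rewrite /kernel_diag kernel_at0 horner0 add0r /val_at Q0_eq1 hornerC expr1n div1r invr_gt0.
  exact: h_gt0.
by rewrite ltr_wpDr// divr_ge0 ?sqr_ge0// ltW// h_gt0.
Qed.

Lemma size_XQ n : size ('X * Q n) = n.+2.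
Proof. by rewrite mulrC size_mulX ?Q_neq0// size_Q. Qed.
Lemma coef_XQ n : ('X * Q n)`_n.+1 = 1.
Proof. by rewrite coefXM/= Q_lead. Qed.

(** The difference Q_(n+1) - X Q_n - t_n K_(n+1) has degree at most n.  It is
orthogonal to multiples of u, because [B_ibp] turns <X Q_n, u g> into the pairing of
Q_n with a polynomial of lower degree, and the choice of t_n makes it
orthogonal to 1. *)
Lemma Q_step n : Q n.+1 = 'X * Q n + step_coef n *: kernel_at n.+1.
Proof.
suff : Q n.+1 - 'X * Q n - step_coef n *: kernel_at n.+1 = 0.
  by move/eqP; rewrite !subr_eq add0r addrC => /eqP ->.
apply: (@B_eq0 n.+1).
  rewrite (leq_trans (size_polyD _ _))// geq_max size_polyN.
  rewrite (leq_trans (size_scale_leq _ _)) ?size_kernel_at// andbT.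
  rewrite -opprB size_polyN -[Q n.+1]scale1r -(coef_XQ n).
  by rewrite size_sub_lead ?size_XQ.
move=> q sq; have [g hg] := poly_XsubC_decomp a q.
have sg : (size g <= n)%N.
  apply: (@size_XsubC_mul_le _ a); rewrite (_ : _ * g = q - (q.[a])%:P).
    rewrite (leq_trans (size_polyD _ _))// geq_max sq size_polyN.
    by rewrite (leq_trans (size_polyC_leq1 _)).
  by rewrite {1}hg addrK.
rewrite 4!BE BZl B_kernel_at// (Q_orth_lt (leqnn _) sq).
rewrite {1}hg BDr -[(q.[a])%:P]mulr1 mul_polyC BZr.
have /(congr1 (fun x => x / nu)) := B_ibp (Q n) g.
rewrite mulrAC divff ?gt_eqF// mul1r => ->.
rewrite (Q_orth_lt (leqnn n)) ?mul0r; last first.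
  rewrite (leq_trans (size_polyD _ _))// geq_max.
  rewrite (leq_trans (size_scale_leq _ _)) ?andbT//.
  case: n sg {hg sq} => [|n] sg; last exact: size_XsubC_deriv.
  by move: sg; rewrite leqn0 size_poly_eq0 => /eqP ->; rewrite linear0 mulr0 size_poly0.
by rewrite /step_coef; ring.
Qed.

Lemma val_at_step n : val_at n.+1 = a * val_at n + step_coef n * kernel_diag n.+1.
Proof. by rewrite /val_at {1}Q_step !hornerE. Qed.

(** Pair X Q_n with Q_(n+1) = u g + Q_(n+1)(a): the first part is computed by
[B_ibp], where only the leading coefficient n+1+c of u g' + (1 + c) g matters,
and the second part is the definition of the step coefficient. *)
Lemma h_step n : h n.+1 = (n.+1%:R + c) / nu * h n - val_at n.+1 * step_coef n.
Proof.
have [g hg] := poly_XsubC_decomp a (Q n.+1).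
have sg : (size g <= n.+1)%N.
  apply: (@size_XsubC_mul_le _ a); rewrite (_ : _ * g = Q n.+1 - (val_at n.+1)%:P).
    rewrite (leq_trans (size_polyD _ _))// geq_max size_Q leqnn size_polyN.
    by rewrite (leq_trans (size_polyC_leq1 _)).
  by rewrite {1}hg addrK.
have gn : g`_n = 1.
  have := Q_lead n.+1; rewrite {1}hg coefD coef_XsubC_mul// coefC/= addr0.
  by [].
transitivity (B ('X * Q n) (Q n.+1)).
  by rewrite B_sym B_Q ?size_XQ// coef_XQ mul1r.
rewrite {1}hg BDr -[(_.[a])%:P]mulr1 mul_polyC BZr -/(val_at _).
have /(congr1 (fun x => x / nu)) := B_ibp (Q n) g.
rewrite mulrAC divff ?gt_eqF// mul1r => ->.
rewrite B_Q; last first.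
  rewrite (leq_trans (size_polyD _ _))// geq_max size_XsubC_deriv//=.
  by rewrite (leq_trans (size_scale_leq _ _)).
rewrite coefD coefZ coef_XsubC_deriv// gn /step_coef -(natr1 n); field.
by rewrite gt_eqF.
Qed.

(** Both sides have the same leading coefficient, so it is enough to pair
their difference with polynomials q of degree at most n; [B_ibp] read from
right to left gives the pairing of u Q_(n+1)' with q. *)
Lemma Q_deriv n : u * (Q n.+1)^`() =
  n.+1%:R *: Q n.+1 - (a * nu * step_coef n.+1) *: kernel_at n.+1
  - (a * nu * (h n.+1 / h n)) *: Q n.
Proof.
apply/eqP; rewrite -subr_eq0; apply/eqP; apply: (@B_eq0 n.+1).
  rewrite !opprD !opprK !addrA.
  rewrite (leq_trans (size_polyD _ _))// geq_max.
  rewrite (leq_trans (size_scale_leq _ _)) ?size_Q ?andbT//.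
  rewrite (leq_trans (size_polyD _ _))// geq_max.
  rewrite (leq_trans (size_scale_leq _ _)) ?size_kernel_at ?andbT//.
  have e := @coef_XsubC_deriv _ a (Q n.+1) n.+1.
  rewrite size_Q Q_lead mulr1 in e; rewrite -e//.
  by rewrite size_sub_lead ?size_Q// size_XsubC_deriv ?size_Q.
move=> q sq.
have hh := h_gt0 n.
have -> : B (u * (Q n.+1)^`() - (n.+1%:R *: Q n.+1 - (a * nu * step_coef n.+1) *: kernel_at n.+1
  - (a * nu * (h n.+1 / h n)) *: Q n)) q =
  B (u * (Q n.+1)^`()) q - (n.+1%:R * B (Q n.+1) q - (a * nu * step_coef n.+1) * B (kernel_at n.+1) q
  - (a * nu * (h n.+1 / h n)) * B (Q n) q) by rewrite !BE.
rewrite B_kernel_at// (B_Q sq) (Q_orth_lt (leqnn _) sq).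
have := B_ibp q (Q n.+1).
rewrite BDr BZr (B_sym q (Q _)) (Q_orth_lt (leqnn _) sq) mulr0 addr0.
rewrite (B_sym q) => <-.
have sXq : (size ('X * q)%R <= n.+2)%N.
  by rewrite mulrC (leq_trans (size_polyMleq _ _))// size_polyX addnS addn1.
rewrite mulrBl BDr BNr mul_polyC BZr (B_sym _ (Q n.+1)) B_Q// coefXM/=.
have -> : 'X * Q n.+1 = Q n.+2 - step_coef n.+1 *: kernel_at n.+2 by rewrite (Q_step n.+1) addrK.
rewrite (B_sym _ (_ - _)) BDl BNl BZl B_kernel_at//.
rewrite (Q_orth_lt (leqnn _) sXq) hornerM hornerX.
by field; rewrite gt_eqF.
Qed.

Lemma val_at_deriv n : n.+1%:R * val_at n.+1 =
  a * nu * (step_coef n.+1 * kernel_diag n.+1 + h n.+1 / h n * val_at n).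
Proof.
have := congr1 (fun p => p.[a]) (Q_deriv n).
rewrite /u !hornerE /= subrr mul0r -/(val_at _) -/(val_at _) -/(kernel_diag _) => e.
lra.
Qed.

(** * Positivity of the orthogonal polynomials at a *)

Let D p q := nu * B (u * p) (u * q) - (1 + c) * B p q.

Lemma numberE p q : D p q = B (u * p^`() - (a * nu) *: (u * p)) q.
Proof.
have := B_ibp q p; rewrite (_ : 'X * q = u * q + a *: q); last first.
  by rewrite /u mulrBl mul_polyC subrK.
rewrite -/u BDr !BDl BZl BZr BNl BZl (B_sym _ (u * _)) (B_sym q (u * _)).
by rewrite (B_sym q (u * p^`())) (B_sym q p) /D => e; lra.
Qed.

Lemma deriv_sub_scale_neq0 (k : R) (s : {poly R}) :
  k != 0 -> s != 0 -> s^`() - k *: s != 0.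
Proof.
move=> k0 s0; rewrite subr_eq0; apply: contraTneq (lt_size_deriv s0) => ->.
by rewrite size_scale// ltnn.
Qed.

(** If a nonnegative quadratic form vanishes at s, then s is in its radical.
The vector q that represents D(s, .) through B is nonzero, since s' = a nu s is
impossible for a polynomial s != 0, and moving from s in the direction -q would
make D negative. *)
Lemma number_gt0 s : s != 0 -> 0 < D s s.
Proof.
move=> s0; have D_ge0 p : 0 <= D p p by rewrite subr_ge0 B_number.
rewrite lt_neqAle D_ge0 andbT eq_sym; apply/negP => /eqP Ds0.
have [q qE] : exists q, q = u * s^`() - (a * nu) *: (u * s) by exists (u * s^`() - (a * nu) *: (u * s)).
have Ds r : D s r = B q r by rewrite qE numberE.
have q0 : q != 0.
  rewrite qE scalerAr -mulrBr mulf_neq0 ?polyXsubC_eq0//.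
  by rewrite deriv_sub_scale_neq0// mulf_neq0 ?gt_eqF.
have DE e : D (s - e *: q) (s - e *: q) = e ^+ 2 * D q q - 2 * e * B q q.
  have -> : D (s - e *: q) (s - e *: q) = D s s - 2 * e * D s q + e ^+ 2 * D q q.
    rewrite /D !mulrBr -!(scalerAr _ u) !BDl !BDr !BNl !BNr !BZl !BZr (B_sym q s).
    by rewrite (B_sym (u * q) (u * s)); ring.
  by rewrite Ds0 Ds; ring.
have bq := B_gt0 q0; set b := B q q in bq DE; set d := D q q in DE.
have d0 : 0 <= d := D_ge0 q.
(* The denominator d + 1 avoids dividing by D q q, which may be 0. *)
have := D_ge0 (s - (b / (d + 1)) *: q); rewrite DE.
have -> : (b / (d + 1)) ^+ 2 * d - 2 * (b / (d + 1)) * b =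
   - (b ^+ 2 * (d + 2) / (d + 1) ^+ 2) by field; lra.
by rewrite oppr_ge0 leNgt divr_gt0 ?mulr_gt0 ?exprn_gt0//; lra.
Qed.

Lemma poly_deriv_sub_surj (k : R) m (g : {poly R}) : k != 0 -> (size g <= m)%N ->
  exists2 s : {poly R}, (size s <= m)%N & s^`() - k *: s = g.
Proof.
move=> k0; elim: m g => [|m IH] g sg.
  move: sg; rewrite leqn0 size_poly_eq0 => /eqP ->.
  by exists 0; rewrite ?size_poly0// linear0 scaler0 subrr.
have [|s ss hs] := IH (k^-1 *: g^`()).
  rewrite (leq_trans (size_scale_leq _ _))//; apply/leq_sizeP => j lj.
  by rewrite coef_deriv (leq_sizeP _ _ sg) ?mul0rn.
exists (s - k^-1 *: g).
  rewrite (leq_trans (size_polyD _ _))// geq_max size_polyN leqW//=.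
  by rewrite (leq_trans (size_scale_leq _ _)).
rewrite derivB derivZ scalerBr scalerA divff// scale1r opprB [g - _]addrC addrACA hs.
by rewrite addrA subrr add0r.
Qed.

(** The combination Q_n(a) Q_(n+1) - Q_(n+1)(a) Q_n vanishes at a, so it is
u (s' - a nu s) for some s of degree n.  Pairing it with s leaves only the Q_n
term, and [number_gt0] says that the result is positive; up to positive factors
it is Q_n(a) Q_(n+1)(a). *)
Lemma val_at_gt0 n : 0 < val_at n.
Proof.
elim: n => [|n IH]; first by rewrite /val_at Q0_eq1 hornerC.
have [g hg] := poly_XsubC_decomp a (val_at n *: Q n.+1 - val_at n.+1 *: Q n).
have q0 : (val_at n *: Q n.+1 - val_at n.+1 *: Q n).[a] = 0.
  by rewrite !hornerE -/(val_at _) -/(val_at _) mulrC subrr.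
rewrite q0 addr0 in hg.
have sg : (size g <= n.+1)%N.
  apply: (@size_XsubC_mul_le _ a); rewrite -hg.
  rewrite (leq_trans (size_polyD _ _))// geq_max size_polyN.
  by rewrite !(leq_trans (size_scale_leq _ _)) ?size_Q.
have gn : g`_n = val_at n.
  rewrite -(@coef_XsubC_mul _ a)// -hg coefB !coefZ Q_lead nth_default ?size_Q//.
  by rewrite mulr0 subr0 mulr1.
have k0 : a * nu != 0 by rewrite mulf_neq0 ?gt_eqF.
have [s ss hs] := poly_deriv_sub_surj k0 sg.
have sn : - (a * nu * s`_n) = val_at n.
  rewrite -gn -hs coefB coefZ coef_deriv [s`_n.+1]nth_default ?mul0rn ?sub0r//.
have s0 : s != 0.
  by apply/eqP => s0; move: sn; rewrite s0 coef0 mulr0 oppr0; lra.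
have := number_gt0 s0; rewrite numberE scalerAr -mulrBr hs -/u -hg.
rewrite BDl BNl !BZl B_Q ?(leq_trans ss)// B_Q//.
rewrite [s`_n.+1]nth_default// mul0r mulr0 add0r => H.
have {}H : 0 < (a * nu) * - (val_at n.+1 * (s`_n * h n)) by rewrite pmulr_rgt0// mulr_gt0.
rewrite (_ : _ * - _ = val_at n.+1 * (val_at n * h n)) in H; last by rewrite -sn; ring.
by move: H; rewrite pmulr_lgt0// mulr_gt0// h_gt0.
Qed.

(** * The step coefficients do not vanish *)

(** This is [val_at_deriv], with h_(n+1) expanded by [h_step] and the left-hand
side by [val_at_step]. *)
Lemma step_coef_rec n : a * nu * step_coef n.+1 * kernel_diag n.+1 =
  - (a * c * val_at n) + step_coef n * (n.+1%:R * kernel_diag n.+1 + a * nu * val_at n.+1 * val_at n / h n).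
Proof.
have := val_at_deriv n; rewrite h_step; have := val_at_step n => e1 e2.
have hn : h n != 0 by rewrite gt_eqF ?h_gt0.
have nun : nu != 0 by rewrite gt_eqF.
have -> : a * nu * step_coef n.+1 * kernel_diag n.+1 = n.+1%:R * val_at n.+1
  - a * nu * (((n.+1%:R + c) / nu * h n - val_at n.+1 * step_coef n) / h n * val_at n).
  by rewrite e2; ring.
rewrite {1}e1; field; exact/andP.
Qed.

(** Put T_m = - c t_m.  In the recursion T_m >= 0 forces T_(m+1) > 0 and
(m+1) T_m <= a nu T_(m+1).  So t_n = 0 would start factorial growth of T; a
rescaling of T that depends on the sign of c is bounded, a contradiction. *)
Lemma step_coef_neq0 n : c != 0 -> step_coef n != 0.
Proof.
move=> c0; apply/negP => /eqP tn.
pose T m := - (c * step_coef m).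
have k0 : 0 < a * nu by rewrite mulr_gt0.
have Trec m : a * nu * kernel_diag m.+1 * T m.+1 = a * c ^+ 2 * val_at m +
   T m * (m.+1%:R * kernel_diag m.+1 + a * nu * val_at m.+1 * val_at m / h m).
  by rewrite /T; have := step_coef_rec m => e; rewrite mulrN mulrCA [_ * step_coef m.+1]mulrAC e; ring.
have c2 : 0 < c ^+ 2 by rewrite exprn_even_gt0.
have pos m : 0 <= a * nu * val_at m.+1 * val_at m / h m.
  by rewrite divr_ge0 ?mulr_ge0 ?ltW ?val_at_gt0 ?h_gt0.
have ac2 m : 0 < a * c ^+ 2 * val_at m.
  by apply: mulr_gt0; [exact: mulr_gt0|exact: val_at_gt0].
have Tgt0 m : 0 <= T m -> 0 < T m.+1.
  move=> Tm; rewrite -(pmulr_rgt0 _ (mulr_gt0 k0 (kernel_diag_gt0 m))) Trec.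
  apply: ltr_wpDr; last exact: ac2.
  by apply/mulr_ge0/addr_ge0 => //; rewrite mulr_ge0// ltW// kernel_diag_gt0.
(* The recursion keeps T positive once it is nonnegative. *)
have TS m : (n < m)%N -> 0 < T m.
  elim: m => // m IH; rewrite ltnS leq_eqVlt => /orP[/eqP <-|/IH/ltW]; last exact: Tgt0.
  by apply: Tgt0; rewrite /T tn mulr0 oppr0.
have Tgrow m : (n < m)%N -> m.+1%:R * T m <= a * nu * T m.+1.
  move=> /TS Tm; rewrite -(ler_pM2r (kernel_diag_gt0 m)) [leRHS]mulrAC Trec.
  have := ac2 m.
  have : 0 <= T m * (a * nu * val_at m.+1 * val_at m / h m) by rewrite mulr_ge0// ltW.
  by lra.
have [c_lt0|c_gt0|] := ltgtP c 0; last by move/eqP; rewrite (negPf c0).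
- have tau_gt0 m : (n < m)%N -> 0 < step_coef m.
    by move=> /TS; rewrite /T -mulNr pmulr_rgt0// oppr_gt0.
  (* For c < 0 the step coefficients are positive, so T_m kernel_diag_(m+1) is at most
     - c Q_(m+1)(a) and Q_(m+1)(a) t_m is at most (m+1) h_m / nu; their product bounds x. *)
  pose x m := T m ^+ 2 * kernel_diag m.+1 / h m / m.+1%:R.
  have x_gt0 m : (n < m)%N -> 0 < x m.
    by move=> /TS Tm; rewrite /x !divr_gt0 ?mulr_gt0 ?exprn_gt0 ?kernel_diag_gt0 ?h_gt0.
  apply: (@unbounded_factorial_growth _ ((2 * a ^+ 2 * nu)^-1) (c ^+ 2 / nu) x n.+1) => //.
  + by rewrite invr_gt0 !mulr_gt0 ?exprn_gt0.
  + move=> m nm; have Tm := TS _ nm; have Tg := Tgrow _ nm.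
    have hm := h_gt0 m; have hm1 := h_gt0 m.+1.
    have hS : nu * h m.+1 <= m.+1%:R * h m.
      rewrite h_step mulrBr mulrA mulrCA divff ?gt_eqF// mulr1.
      have : 0 <= nu * (val_at m.+1 * step_coef m).
        by rewrite !mulr_ge0 ?ltW ?val_at_gt0 ?tau_gt0.
      have : c * h m <= 0 by rewrite mulr_le0_ge0// ltW.
      by lra.
    have kS : kernel_diag m.+1 <= kernel_diag m.+2.
      by rewrite (kernel_diagS m.+1) lerDl divr_ge0 ?sqr_ge0 ?ltW.
    have TT : (m.+1%:R * T m) ^+ 2 <= (a * nu * T m.+1) ^+ 2.
      by rewrite ler_sqr ?nnegrE// ?mulr_ge0// ltW ?TS// leqW.
    have km := kernel_diag_gt0 m; have km1 := kernel_diag_gt0 m.+1.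
    have m1 : 0 < m.+1%:R :> R by [].
    have m2 : 0 < m.+2%:R :> R by [].
    have m12 : m.+2%:R <= 2 * m.+1%:R :> R.
      by rewrite -natrM ler_nat mul2n -addnn addSn ltnS leq_addl.
    rewrite -(ler_pM2r m2) /x divfK ?gt_eqF// -(ler_pM2r hm1) divfK ?gt_eqF//.
    set A := T m ^+ 2 * kernel_diag m.+1.
    have A0 : 0 < A by rewrite mulr_gt0// exprn_gt0.
    apply: (@le_trans _ _ ((2 * a ^+ 2 * nu)^-1 * m.+2%:R * A * (m.+1%:R / nu))).
      have -> : (2 * a ^+ 2 * nu)^-1 * m.+1%:R * (A / h m / m.+1%:R) * m.+2%:R * h m.+1
        = (2 * a ^+ 2 * nu)^-1 * m.+2%:R * A * (h m.+1 / h m).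
        by field; rewrite nat1r !gt_eqF.
      rewrite ler_wpM2l//; last by rewrite ler_pdivrMr// mulrAC ler_pdivlMr// mulrC.
      by rewrite !mulr_ge0// ?invr_ge0 ?mulr_ge0 ?sqr_ge0// ltW.
    apply: (@le_trans _ _ ((a * nu)^-2 * ((m.+1%:R * T m) ^+ 2 * kernel_diag m.+1))).
      have -> : (2 * a ^+ 2 * nu)^-1 * m.+2%:R * A * (m.+1%:R / nu) =
        (m.+2%:R / 2) * ((a * nu)^-2 * (m.+1%:R * A)).
        by rewrite /A; field; rewrite !gt_eqF.
      have -> : (m.+1%:R * T m) ^+ 2 * kernel_diag m.+1 = m.+1%:R * (m.+1%:R * A) by rewrite /A; ring.
      rewrite [leRHS]mulrCA ler_wpM2r//; last lra.
      by rewrite !mulr_ge0// ?invr_ge0 ?exprn_ge0// ltW.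
    rewrite -exprVn -ler_pdivlMl ?exprn_gt0 ?invr_gt0// exprVn invrK.
    rewrite mulrA -exprMn ler_pM// ?sqr_ge0//; exact: ltW.
  + move=> m nm; have hm := h_gt0 m.
    rewrite /x !ler_pdivrMr//.
    have t0 := tau_gt0 _ nm.
    have e1 : step_coef m * kernel_diag m.+1 <= val_at m.+1.
      by rewrite val_at_step lerDr mulr_ge0// ltW// val_at_gt0.
    have e2 : val_at m.+1 * step_coef m <= m.+1%:R / nu * h m.
      have := h_gt0 m.+1; rewrite h_step.
      have : c / nu * h m <= 0.
        by rewrite mulr_le0_ge0 ?(ltW hm)// mulr_le0_ge0 ?(ltW c_lt0)// ltW// invr_gt0.
      lra.
    rewrite /T [leLHS](_ : _ = c ^+ 2 * (step_coef m * (step_coef m * kernel_diag m.+1))); last by ring.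
    rewrite [leRHS](_ : _ = c ^+ 2 * (m.+1%:R / nu * h m)); last by ring.
    rewrite ler_wpM2l ?sqr_ge0//; apply: le_trans e2.
    by rewrite mulrC ler_wpM2r// ltW.
- have tau_lt0 m : (n < m)%N -> step_coef m < 0.
    by move=> /TS; rewrite /T oppr_gt0 pmulr_rlt0.
  (* For c > 0 they are negative, so Q_(m+1)(a) > 0 bounds T_m kernel_diag_(m+1) by
     c a Q_m(a). *)
  pose x m := T m / val_at m.
  have x_gt0 m : (n < m)%N -> 0 < x m by move=> /TS Tm; rewrite /x divr_gt0 ?val_at_gt0.
  apply: (@unbounded_factorial_growth _ ((a ^+ 2 * nu)^-1) (c * a / kernel_diag 1) x n.+1) => //.
  + by rewrite invr_gt0 !mulr_gt0 ?exprn_gt0.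
  + move=> m nm; have Tg := Tgrow _ nm.
    have pm := val_at_gt0 m; have pm1 := val_at_gt0 m.+1.
    have p1 : val_at m.+1 <= a * val_at m.
      by rewrite val_at_step gerDl pmulr_lle0 ?kernel_diag_gt0// ltW// tau_lt0.
    rewrite /x ler_pdivlMr//.
    apply: (@le_trans _ _ ((a ^+ 2 * nu)^-1 * m.+1%:R * (T m / val_at m) * (a * val_at m))).
      rewrite ler_wpM2l// !mulr_ge0 ?invr_ge0 ?mulr_ge0 ?sqr_ge0 ?ltW// ?TS//.
    have -> : (a ^+ 2 * nu)^-1 * m.+1%:R * (T m / val_at m) * (a * val_at m)
      = (m.+1%:R * T m) / (a * nu) by field; rewrite !gt_eqF.
    by rewrite ler_pdivrMr// [leRHS]mulrC.
  + move=> m nm; have pm := val_at_gt0 m; have pm1 := val_at_gt0 m.+1.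
    rewrite /x ler_pdivrMr// mulrAC ler_pdivlMr ?kernel_diag_gt0//.
    have kS j : kernel_diag 1 <= kernel_diag j.+1.
      by elim: j => // j IH; rewrite (le_trans IH)// (kernel_diagS j.+1) lerDl divr_ge0 ?sqr_ge0 ?ltW ?h_gt0.
    apply: (@le_trans _ _ (T m * kernel_diag m.+1)); first by rewrite ler_wpM2l// ltW// TS.
    rewrite /T mulNr -mulrA -mulrN -mulrA ler_wpM2l ?(ltW c_gt0)//.
    by move: pm1; rewrite val_at_step; lra.
Qed.

Lemma step_coef_step n : a * nu * step_coef n.+2 / val_at n.+2 =
  a * nu * step_coef n.+1 / val_at n.+1 + (n.+2%:R + c) * step_coef n.+1 / val_at n.+2
  - nu * (h n.+1 / h n) * step_coef n / val_at n.+1.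
Proof.
have p1 : val_at n.+1 != 0 by rewrite gt_eqF ?val_at_gt0.
have p2 : val_at n.+2 != 0 by rewrite gt_eqF ?val_at_gt0.
have k1 : kernel_diag n.+1 != 0 by rewrite gt_eqF ?kernel_diag_gt0.
have k2 : kernel_diag n.+2 != 0 by rewrite gt_eqF ?kernel_diag_gt0.
have h0 : h n != 0 by rewrite gt_eqF ?h_gt0.
have h1 : h n.+1 != 0 by rewrite gt_eqF ?h_gt0.
have nun : nu != 0 by rewrite gt_eqF.
apply: (mulIf (mulf_neq0 p1 (mulf_neq0 p2 k2))).
have -> : a * nu * step_coef n.+2 / val_at n.+2 * (val_at n.+1 * (val_at n.+2 * kernel_diag n.+2)) =
  (a * nu * (step_coef n.+2 * kernel_diag n.+2)) * val_at n.+1 by field; rewrite p2.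
have -> : a * nu * (step_coef n.+2 * kernel_diag n.+2) =
  n.+2%:R * val_at n.+2 - a * nu * (h n.+2 / h n.+1 * val_at n.+1).
  by rewrite val_at_deriv; ring.
have -> : (a * nu * step_coef n.+1 / val_at n.+1 + (n.+2%:R + c) * step_coef n.+1 / val_at n.+2
  - nu * (h n.+1 / h n) * step_coef n / val_at n.+1) * (val_at n.+1 * (val_at n.+2 * kernel_diag n.+2)) =
  val_at n.+2 * (a * nu * (step_coef n.+1 * kernel_diag n.+2))
  + (n.+2%:R + c) * (step_coef n.+1 * kernel_diag n.+2) * val_at n.+1
  - nu * (h n.+1 / h n) * val_at n.+2 * (step_coef n * kernel_diag n.+2) by field; rewrite p1 p2 h0.
have -> : a * nu * (step_coef n.+1 * kernel_diag n.+2) = n.+1%:R * val_at n.+1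
   - a * nu * (h n.+1 / h n * val_at n) + a * nu * step_coef n.+1 * (val_at n.+1 ^+ 2 / h n.+1).
  by rewrite val_at_deriv (kernel_diagS n.+1); ring.
have -> : step_coef n * kernel_diag n.+2 =
    val_at n.+1 - a * val_at n + step_coef n * (val_at n.+1 ^+ 2 / h n.+1).
  by rewrite (kernel_diagS n.+1) mulrDr (val_at_step n); ring.
have -> : step_coef n.+1 * kernel_diag n.+2 = val_at n.+2 - a * val_at n.+1 by rewrite (val_at_step n.+1); ring.
rewrite (h_step n.+1).
have -> : nu * (h n.+1 / h n) * val_at n.+2 *
    (val_at n.+1 - a * val_at n + step_coef n * (val_at n.+1 ^+ 2 / h n.+1))
  = nu * (h n.+1 / h n) * val_at n.+2 * (val_at n.+1 - a * val_at n)
    + nu * val_at n.+2 * step_coef n * (val_at n.+1 ^+ 2 / h n) by field; rewrite h0 h1.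
have -> : nu * (h n.+1 / h n) * val_at n.+2 * (val_at n.+1 - a * val_at n) =
  (((n.+1%:R + c) - nu * val_at n.+1 * step_coef n / h n)) * val_at n.+2 * val_at n.+1
   - nu * (h n.+1 / h n) * val_at n.+2 * (a * val_at n).
  by rewrite (h_step n); field; rewrite nun h0.
by rewrite -(natr1 n.+1) -(natr1 n); field; rewrite nun h0 h1.
Qed.

(** * The algebraic Christoffel-Darboux identity *)

(** The operator p |-> (X - a)^(1-c) ((X - a)^c p)': it differentiates
(X - a)^c p and clears the denominator. *)
Definition euler_op (p : {poly R}) := u * p^`() + c *: p.

Lemma euler_op_Q n : euler_op (Q n.+1) =
  (n.+1%:R + c) *: Q n.+1 - (a * nu * step_coef n.+1) *: kernel_at n.+1
  - (a * nu * (h n.+1 / h n)) *: Q n.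
Proof. by rewrite /euler_op Q_deriv scalerDl -!addrA; congr (_ + _); rewrite addrA addrC. Qed.

Lemma u_Q n : u * Q n = Q n.+1 - step_coef n *: kernel_at n.+1 - a *: Q n.
Proof. by rewrite Q_step addrK /u mulrBl mul_polyC. Qed.

(** After expansion in Q_(n+2), Q_(n+1) and K_(n+1), the coefficients of
K_(n+1) agree by [step_coef_step] and those of Q_(n+1) by that and [h_step]. *)
Lemma euler_op_step n : euler_op (Q n.+2) = (val_at n.+2 / val_at n.+1) *: euler_op (Q n.+1)
  + (n.+2%:R + c) *: (u * Q n.+1)
  - (val_at n.+2 / val_at n.+1 * (nu * (h n.+1 / h n))) *: (u * Q n).
Proof.
have p1 : val_at n.+1 != 0 by rewrite gt_eqF ?val_at_gt0.
have p2 : val_at n.+2 != 0 by rewrite gt_eqF ?val_at_gt0.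
have h0 : h n != 0 by rewrite gt_eqF ?h_gt0.
have h1 : h n.+1 != 0 by rewrite gt_eqF ?h_gt0.
have nun : nu != 0 by rewrite gt_eqF.
set r := val_at n.+2 / val_at n.+1; set s := nu * (h n.+1 / h n).
have eK : a * nu * step_coef n.+2 = r * (a * nu * step_coef n.+1)
    + (n.+2%:R + c) * step_coef n.+1 - r * s * step_coef n.
  have /(congr1 (fun x => val_at n.+2 * x)) := step_coef_step n.
  rewrite mulrCA divff// mulr1 => ->; rewrite /r /s; field.
  by rewrite h0 p1 p2.
have eQ : a * nu * step_coef n.+2 * (val_at n.+1 / h n.+1) + a * nu * (h n.+2 / h n.+1)
  = (n.+2%:R + c) * (step_coef n.+1 * (val_at n.+1 / h n.+1) + a) - r * (n.+1%:R + c) + r * s.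
  have es : nu * val_at n.+1 * step_coef n / h n = n.+1%:R + c - s.
    by rewrite /s (h_step n); field; rewrite h0 nun.
  rewrite eK mulrBl [X in _ - X](_ : _ = r * (n.+1%:R + c - s)); last first.
    by rewrite -es /s; field; rewrite h0 h1.
  by rewrite (h_step n.+1) /r; field; rewrite h1 nun p1.
rewrite !euler_op_Q !u_Q (kernel_atS n.+1).
set k2 := n.+2%:R + c in eK eQ *; set k1 := n.+1%:R + c in eK eQ *.
transitivity (k2 *: Q n.+2 - (a * nu * step_coef n.+2) *: kernel_at n.+1
   - (a * nu * step_coef n.+2 * (val_at n.+1 / h n.+1) + a * nu * (h n.+2 / h n.+1)) *: Q n.+1).
  by rewrite -!mul_polyC; ring.
rewrite eQ eK /s -!mul_polyC; ring.
Qed.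

Section Evaluation.
Variables (F : fieldType) (f : {rmorphism R -> F}).
Local Notation ev z p := ((map_poly f p).[z]).

Lemma evD z p q : ev z (p + q) = ev z p + ev z q.
Proof. by rewrite rmorphD hornerD. Qed.
Lemma evN z p : ev z (- p) = - ev z p.
Proof. by rewrite rmorphN hornerN. Qed.
Lemma evZ z k p : ev z (k *: p) = f k * ev z p.
Proof. by rewrite map_polyZ hornerZ. Qed.
Lemma evM z p q : ev z (p * q) = ev z p * ev z q.
Proof. by rewrite rmorphM hornerM. Qed.
Lemma evX z : ev z 'X = z.
Proof. by rewrite map_polyX hornerX. Qed.
Lemma ev1 z : ev z 1 = 1.
Proof. by rewrite rmorph1 hornerC. Qed.
Lemma evu z : ev z u = z - f a.
Proof. by rewrite evD evN evX map_polyC hornerC. Qed.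

(** In the induction step, x Q_(n+1)(x) is replaced through [Q_step] and
euler_op Q_(n+2) through [euler_op_step]; both sides are then the same
combination of Q_(n+1)(x), Q_(n+2)(x) and K_(n+1)(x), with coefficients in y. *)
Lemma christoffel_darboux n x y :
  \sum_(j < n.+1) (f (h j))^-1 * ev x (Q j) *
     (ev y (euler_op (Q j)) - f nu * x * (y - f a) * ev y (Q j)) =
  (ev y (euler_op (Q n.+1)) * ev x (kernel_at n.+1)
   - f (nu * (h n.+1 / h n)) * (y - f a) * ev y (Q n) * ev x (kernel_at n.+2)) / f (val_at n.+1).
Proof.
have f0 (k : R) : k != 0 -> f k != 0 by rewrite fmorph_eq0.
have nun : f nu != 0 by rewrite f0 ?gt_eqF.
have pn j : f (val_at j) != 0 by rewrite f0 ?gt_eqF ?val_at_gt0.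
have hn j : f (h j) != 0 by rewrite f0 ?gt_eqF ?h_gt0.
have fh j : f (h j.+1) = (j.+1%:R + f c) / f nu * f (h j) - f (val_at j.+1) * f (step_coef j).
  by rewrite h_step rmorphB !rmorphM fmorphV rmorphD rmorph_nat.
have evK j z : ev z (kernel_at j.+1) = ev z (kernel_at j) + f (val_at j) / f (h j) * ev z (Q j).
  by rewrite kernel_atS evD evZ rmorphM fmorphV.
elim: n => [|n IH].
  have eK z : ev z (kernel_at 1) = (f (h 0))^-1.
    by rewrite evK kernel_at0 /val_at Q0_eq1 hornerC rmorph1 ev1 rmorph0 horner0 add0r mulr1 div1r.
  have eQ z : ev z (Q 1) = z + f (step_coef 0) / f (h 0).
    by rewrite Q_step evD evZ evM evX Q0_eq1 ev1 mulr1 eK.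
  have Q1' : (Q 1)^`() = 1.
    rewrite Q_step kernel_atS kernel_at0 add0r /val_at Q0_eq1 mulr1 derivD derivX !derivZ.
    by rewrite -[1 in X in _ *: (_ *: X)]/(1%:P) derivC !scaler0 addr0.
  have ep : f (val_at 1) = f a + f (step_coef 0) / f (h 0).
    rewrite val_at_step /kernel_diag kernel_atS kernel_at0 add0r hornerZ /val_at Q0_eq1.
    by rewrite hornerC mulr1 div1r mulr1 rmorphD rmorphM fmorphV.
  have L0 : ev y (euler_op (Q 0)) = f c.
    by rewrite /euler_op Q0_eq1 -[1]/(1%:P) derivC mulr0 add0r evZ ev1 mulr1.
  have L1 : ev y (euler_op (Q 1)) = (y - f a) + f c * ev y (Q 1).
    by rewrite /euler_op Q1' mulr1 evD evu evZ.
  rewrite big_ord1 L0 L1 (evK 1%N) !rmorphM fmorphV Q0_eq1 !ev1 eK !eQ.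
  move: (hn 1%N) (pn 1%N) (hn 0%N) nun; rewrite fh ep.
  move: (f (h 0)) (f (step_coef 0)) (f a) (f c) (f nu) => H0 t A C N h1 p1 h0 nun.
  have {}p1 : A * H0 + t != 0.
    by apply: contraNneq p1 => e; rewrite -(mulfK h0 A) -mulrDl e mul0r.
  have {}h1 : (1 + C) * H0 * H0 + - ((A * H0 + t) * t) * N != 0.
    have -> : (1 + C) * H0 * H0 + - ((A * H0 + t) * t) * N =
      ((1 + C) / N * H0 - (A + t / H0) * t) * (H0 * N) by field; rewrite h0.
    by rewrite !mulf_neq0.
  by field; rewrite h0 p1 nun h1.
rewrite big_ord_recr /= IH.
have eX : x * ev x (Q n.+1) = ev x (Q n.+2) - f (step_coef n.+1) * ev x (kernel_at n.+2).
  by rewrite (Q_step n.+1) evD evZ evM evX addrK.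
have eL : ev y (euler_op (Q n.+2)) = f (val_at n.+2) / f (val_at n.+1) * ev y (euler_op (Q n.+1))
  + (n.+2%:R + f c) * ((y - f a) * ev y (Q n.+1))
  - (f (val_at n.+2) / f (val_at n.+1) * (f nu * (f (h n.+1) / f (h n)))) * ((y - f a) * ev y (Q n)).
  rewrite euler_op_step evD evN evD !evZ !(evM y u) evu [f (_ + c)]rmorphD rmorph_nat.
  by rewrite ![f (_ * _)]rmorphM !fmorphV.
have -> : (f (h n.+1))^-1 * ev x (Q n.+1) *
   (ev y (euler_op (Q n.+1)) - f nu * x * (y - f a) * ev y (Q n.+1)) =
  (f (h n.+1))^-1 * (ev x (Q n.+1) * ev y (euler_op (Q n.+1))
     - f nu * (x * ev x (Q n.+1)) * (y - f a) * ev y (Q n.+1)).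
  by ring.
rewrite eX eL !(rmorphM, fmorphV) (evK n.+2) (evK n.+1).
move: (hn n.+2) (hn n.+1) (hn n) (pn n.+1) (pn n.+2).
rewrite (fh n.+1).
move: (ev x (Q n.+2)) (ev x (kernel_at n.+1)) (ev y (euler_op (Q n.+1))) => X2 K1 L1.
move: (ev y (Q n)) (ev x (Q n.+1)) (ev y (Q n.+1)) => Y0 X1 Y1.
move: (f (h n.+1)) (f (h n)) (f (step_coef n.+1)) (f (val_at n.+1)) (f (val_at n.+2)).
move: (n.+2%:R) => m H1 H0 t p q h2 h1 h0 p1 p2.
have {}h2 : (m + f c) * H1 + - (q * t) * f nu != 0.
  have -> : (m + f c) * H1 + - (q * t) * f nu =
    ((m + f c) / f nu * H1 - q * t) * f nu by field.
  by rewrite mulf_neq0.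
by field; rewrite h0 h1 p1 p2 nun h2.
Qed.

End Evaluation.

End OrthogonalPolynomials.

(** * Antisymmetric forms with the integration by parts rule *)

Section Antisymmetric.
Variables (R : realFieldType) (a c nu : R).
Hypotheses (a_neq0 : a != 0) (nu_neq0 : nu != 0).
Variable C : {poly R} -> {poly R} -> R.
Hypothesis C_linear : forall k p q r, C (k *: p + q) r = k * C p r + C q r.
Hypothesis C_anti : forall p q, C p q = - C q p.
Hypothesis C_ibp : forall p g,
  nu * C ('X * p) (('X - a%:P) * g) = C p (('X - a%:P) * g^`() + (1 + c) *: g).

(** First C(g, 1) = 0, by induction on the degree of g = X h + k: the rule
applied to (h, 1) and to (1, h) gives C(X h, X) = a C(X h, 1) and
C(X h, X) = a C(h, X), and the last pairing reduces to lower degree.  Then,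
splitting off constants, the rule lowers the degree of the first argument. *)
Lemma antisym_form_eq0 p q : C p q = 0.
Proof.
have C0l r : C 0 r = 0.
  by have := C_linear 1 0 0 r; rewrite scaler0 addr0 mul1r; lra.
have CDl f g r : C (f + g) r = C f r + C g r.
  by rewrite -[f]scale1r C_linear mul1r scale1r.
have CZl k f r : C (k *: f) r = k * C f r.
  by rewrite -[k *: f]addr0 C_linear C0l addr0.
have CNl f r : C (- f) r = - C f r by rewrite -scaleN1r CZl mulN1r.
have CDr f g r : C r (f + g) = C r f + C r g.
  by rewrite C_anti CDl opprD -!(C_anti r).
have CZr k f r : C r (k *: f) = k * C r f by rewrite C_anti CZl -mulrN -C_anti.
have CNr f r : C r (- f) = - C r f by rewrite C_anti CNl -C_anti.
have Cu r g : C r (('X - a%:P) * g) = C r ('X * g) - a * C r g.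
  by rewrite mulrBl CDr CNr mul_polyC CZr.
have C11 : C 1 1 = 0 by have := C_anti 1 1; lra.
have divnu x : nu * x = 0 -> x = 0.
  by move/eqP; rewrite mulf_eq0 (negPf nu_neq0) => /eqP.
have split0 (g : {poly R}) m : (size g <= m.+1)%N ->
    exists (h : {poly R}) (k : R), (size h <= m)%N /\ g = 'X * h + k *: 1.
  move=> sg; have [h hE] := poly_XsubC_decomp 0 g; rewrite polyC0 subr0 in hE.
  exists h, g.[0]; split; last by rewrite {1}hE -mul_polyC mulr1.
  apply: (@size_XsubC_mul_le _ 0); rewrite polyC0 subr0.
  have -> : 'X * h = g - (g.[0])%:P by rewrite {1}hE addrK.
  rewrite (leq_trans (size_polyD _ _))// geq_max sg size_polyN.
  by rewrite (leq_trans (size_polyC_leq1 _)).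
have d1 : deriv (1 : {poly R}) = 0 := derivC 1.
have e1 h : C h 1 = 0 -> C ('X * h) 'X = a * C ('X * h) 1.
  move=> h1; have := C_ibp h 1; rewrite d1 mulr0 add0r.
  by rewrite Cu CZr h1 mulr0 mulr1 => /divnu/subr0_eq.
have e2 h : C (('X - a%:P) * h^`() + (1 + c) *: h) 1 = 0 -> C ('X * h) 'X = a * C h 'X.
  move=> h1; have := C_ibp 1 h; rewrite mulr1 [RHS]C_anti h1 oppr0 => /divnu.
  by rewrite Cu (C_anti _ ('X * h)) (C_anti _ h) mulrN opprK addrC => /subr0_eq.
have CX1 : C 'X 1 = 0.
  have h1 := e1 1 C11; have h2 := e2 1; rewrite !mulr1 in h1 h2.
  rewrite d1 mulr0 add0r CZl C11 mulr0 in h2.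
  move: (h2 erefl); rewrite h1 => /(mulfI a_neq0); rewrite (C_anti 1); lra.
have C1 m (g : {poly R}) : (size g <= m)%N -> C g 1 = 0.
  elim: m g => [|m IH] g.
    by rewrite leqn0 size_poly_eq0 => /eqP ->.
  move=> /split0[h [k [sh ->]]]; rewrite CDl CZl C11 mulr0 addr0.
  apply: (mulfI a_neq0); rewrite -e1 ?IH// e2; last first.
    apply: (IH); case: m sh {IH} => [|m] sh.
      move: sh; rewrite leqn0 size_poly_eq0 => /eqP ->.
      by rewrite linear0 mulr0 scaler0 addr0 size_poly0.
    rewrite (leq_trans (size_polyD _ _))// geq_max size_XsubC_deriv//=.
    by rewrite (leq_trans (size_scale_leq _ _)).
  rewrite mulr0; suff -> : C h 'X = 0 by rewrite mulr0.
  case: m sh IH => [|m] sh IH.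
    by move: sh; rewrite leqn0 size_poly_eq0 => /eqP ->.
  have [h2 [k2 [sh2 ->]]] := split0 _ _ sh.
  rewrite CDl CZl (C_anti 1) CX1 oppr0 mulr0 addr0 e1 ?IH ?mulr0// ?(leqW sh2)//.
  by rewrite mulrC (leq_trans (size_polyMleq _ _))// size_polyX addn2.
elim/poly_ind: p q => [|p k IH] q; first exact: C0l.
have [g ->] := poly_XsubC_decomp a q.
rewrite CDl mulrC [C (k%:P) _]C_anti -[k%:P]mulr1 mul_polyC CZr (C1 _ _ (leqnn _)) mulr0 oppr0 addr0.
rewrite CDr -[(_.[a])%:P]mulr1 mul_polyC CZr (C1 _ _ (leqnn _)) mulr0 addr0.
by apply: divnu; rewrite C_ibp IH.
Qed.
End Antisymmetric.

(** * Measurability, derivatives and integrals on the line *)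

Section RealMeasurable.
Context d (T : measurableType d) (R : realType).
Implicit Types f g : T -> R.
Lemma measurable_realD f g : measurable_fun setT f -> measurable_fun setT g ->
  measurable_fun setT (fun z => f z + g z).
Proof. exact: measurable_funD. Qed.
Lemma measurable_realM f g : measurable_fun setT f -> measurable_fun setT g ->
  measurable_fun setT (fun z => f z * g z).
Proof. exact: measurable_funM. Qed.
Lemma measurable_realN f : measurable_fun setT f -> measurable_fun setT (fun z => - f z).
Proof.
move=> mf; under eq_fun do rewrite -mulN1r.
by apply: measurable_realM => //; exact: measurable_cst.
Qed.
Lemma measurable_real_cst (k : R) : measurable_fun setT (fun _ : T => k).
Proof. exact: measurable_cst. Qed.
Lemma measurable_real_expR f : measurable_fun setT f -> measurable_fun setT (fun z => expR (f z)).
Proof. by move=> mf; apply: (measurableT_comp (f := @expR R)) => //; exact: measurable_expR. Qed.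
Lemma measurable_real_powR f (q : R) : measurable_fun setT f -> measurable_fun setT (fun z => f z `^ q).
Proof. by move=> mf; apply: (measurableT_comp (f := fun y => y `^ q)) => //; exact: measurable_powR. Qed.
Lemma measurable_real_norm f : measurable_fun setT f -> measurable_fun setT (fun z => `|f z|).
Proof. by move=> mf; apply: (measurableT_comp (f := @Num.norm R R)). Qed.
Lemma measurable_realX f n : measurable_fun setT f -> measurable_fun setT (fun z => f z ^+ n).
Proof. exact: measurable_funX. Qed.
End RealMeasurable.
Ltac measurability := repeat first
  [ assumption | exact: measurable_real_cst | exact: measurable_id
  | exact: measurable_fst | exact: measurable_snd
  | apply: measurable_realD | apply: measurable_realM | apply: measurable_realN | apply: measurable_realX
  | apply: measurable_real_expR | apply: measurable_real_powR | apply: measurable_real_norm ].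

Section OneDim.
Variable R : realType.
Implicit Types (f g F : R -> R) (x a b k q df dg : R).
Local Notation mu := (@lebesgue_measure R).
Local Open Scope classical_set_scope.

Lemma FTC_is_derive f F a b : a < b ->
  (forall x, a <= x <= b -> is_derive x 1 F (f x)) ->
  (forall x, a <= x <= b -> {for x, continuous f}) ->
  (\int[mu]_(x in `[a, b]) (f x)%:E = (F b - F a)%:E)%E.
Proof.
move=> ab dF cf.
have cF x : a <= x <= b -> {for x, continuous F}.
  by move=> xab; apply/differentiable_continuous/derivable1_diffP; have [] := dF _ xab.
rewrite EFinB; apply: continuous_FTC2 => //.
- apply/subspace_continuousP => x /=; rewrite in_itv/= => xab.
  by apply: cvg_within_filter; exact: cf.
- split.
  + by move=> x; rewrite in_itv/= => /andP[ax xb]; have [] := dF x; rewrite ?ltW.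
  + by apply: cvg_at_right_filter; apply: cF; rewrite lexx ltW.
  + by apply: cvg_at_left_filter; apply: cF; rewrite lexx ltW.
- move=> x; rewrite in_itv/= => /andP[ax xb].
  by rewrite derive1E; apply: (@derive_val _ _ _ _ _ _ _ (dF x _)); rewrite !ltW.
Qed.

(** Monotone convergence: the increments of the antiderivative over the
segments bound the integral. *)
Lemma integrable_exhaustion f F (l r : nat -> R) (A : set R) (C : R) :
  (forall n, l n < r n) -> (forall n, l n.+1 <= l n) -> (forall n, r n <= r n.+1) ->
  A = \bigcup_n `[l n, r n]%classic ->
  measurable_fun setT f -> (forall x, 0 <= f x) ->
  (forall x, A x -> is_derive x 1 F (f x)) ->
  (forall x, A x -> {for x, continuous f}) ->
  (forall n, F (r n) - F (l n) <= C) ->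
  mu.-integrable A (EFin \o f).
Proof.
move=> lr ln rn AE mf f0 dF cf FC.
have mA : measurable A.
  by rewrite AE; apply: bigcup_measurable => n _; exact: measurable_itv.
apply/integrableP; split.
  by apply/measurable_EFinP; exact: measurable_funTS.
apply: (@le_lt_trans _ _ C%:E); last by rewrite ltry.
have -> : (\int[mu]_(x in A) `|(EFin \o f) x| = \int[mu]_(x in A) (f x)%:E)%E.
  by apply: eq_integral => x _; rewrite /= ger0_norm.
have lni n m : (n <= m)%N -> l m <= l n.
  by move=> /subnK <-; elim: (m - n)%N => // k IH; rewrite addSn (le_trans _ IH).
have rni n m : (n <= m)%N -> r n <= r m.
  by move=> /subnK <-; elim: (m - n)%N => // k IH; rewrite addSn (le_trans IH).
have nd : nondecreasing_seq (fun n => `[l n, r n]%classic : set R).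
  move=> n m nm; rewrite subsetEset => x /=; rewrite !in_itv/= => /andP[lx xr].
  by rewrite (le_trans (lni _ _ nm))//= (le_trans xr)// rni.
have cv := @ge0_nondecreasing_set_cvg_integral _ (measurableTypeR R) R _ (EFin \o f) mu nd
  (fun n => measurable_itv _).
have {}cv : (\int[mu]_(x in `[l n, r n]) (f x)%:E @[n --> \oo] -->
   \int[mu]_(x in \bigcup_n `[l n, r n]) (f x)%:E)%E.
  apply: cv; last by move=> n x _; rewrite lee_fin.
  by move=> n; apply/measurable_EFinP; exact: measurable_funTS.
rewrite AE -(cvg_lim _ cv)//; apply: lime_le; first by apply/cvg_ex; eexists; exact: cv.
apply: nearW => n.
have lrA x : l n <= x <= r n -> A x by rewrite AE => xlr; exists n => //=; rewrite in_itv.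
rewrite (_ : (\int[mu]_(x in `[l n, r n]) (f x)%:E)%E = (F (r n) - F (l n))%:E) ?lee_fin//.
apply: FTC_is_derive => // x /lrA Ax; [exact: dF | exact: cf].
Qed.

Lemma is_derive1D f g x df dg : is_derive x 1 f df -> is_derive x 1 g dg ->
  is_derive x 1 (fun t => f t + g t) (df + dg).
Proof. exact: is_deriveD. Qed.
Lemma is_derive1N f x df : is_derive x 1 f df -> is_derive x 1 (fun t => - f t) (- df).
Proof. exact: is_deriveN. Qed.
Lemma is_derive1M f g x df dg : is_derive x 1 f df -> is_derive x 1 g dg ->
  is_derive x 1 (fun t => f t * g t) (df * g x + f x * dg).
Proof.
move=> hf hg; have := is_deriveM hf hg; rewrite addrC [g x *: df]mulrC.
exact.
Qed.
Lemma is_derive1_cst x k : is_derive x 1 (fun _ : R => k) (0 : R).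
Proof. exact: is_derive_cst. Qed.
Lemma is_derive1_id x : is_derive x 1 (fun t : R => t) (1 : R).
Proof. exact: is_derive_id. Qed.
Lemma is_derive1_expR f x df : is_derive x 1 f df ->
  is_derive x 1 (fun t => expR (f t)) (expR (f x) * df).
Proof. by move=> hf; exact: (is_derive1_comp (is_derive_expR _) hf). Qed.
Lemma is_derive1_powR' f x df q : is_derive x 1 f df -> 0 < f x ->
  is_derive x 1 (fun t => f t `^ q) (q * f x `^ (q - 1) * df).
Proof. by move=> hf fx; exact: (is_derive1_comp (is_derive1_powR q fx) hf). Qed.

Lemma is_derive1_eq f x df dg : is_derive x 1 f df -> df = dg -> is_derive x 1 f dg.
Proof. by move=> h <-. Qed.

Lemma is_derive1_continuous f x df : is_derive x 1 f df -> {for x, continuous f}.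
Proof. by case=> + _; move/derivable1_diffP/differentiable_continuous. Qed.

(** The sign s selects the side of a, so that both sides share one proof. *)
Lemma integrable_powR_side (s a q : R) : s = 1 \/ s = -1 -> -1 < q ->
  mu.-integrable [set x : R | 0 < s * (x - a) <= 1] (fun x => (`|x - a| `^ q)%:E).
Proof.
move=> hs q1.
have q1' : 0 < q + 1 by lra.
pose eps n : R := n.+2%:R^-1.
have eps_gt0 n : 0 < eps n by rewrite invr_gt0.
have eps_lt1 n : eps n < 1 by rewrite invf_lt1// ltr1n.
have eps_le n : eps n.+1 <= eps n by rewrite lef_pV2 ?posrE// ler_nat.
have ss : s * s = 1 by case: hs => ->; rewrite ?mulr1// mulrNN mulr1.
have sE x : 0 < s * (x - a) -> s * (x - a) = `|x - a|.
  by move=> h; rewrite -(gtr0_norm h) normrM; case: hs => ->; rewrite ?normrN normr1 mul1r.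
pose f x := (s * (x - a)) `^ q.
have mA : measurable [set x : R | 0 < s * (x - a) <= 1].
  have ms : measurable_fun setT (fun x : R => s * (x - a)) by measurability.
  have := ms measurableT `]0, 1]%classic (measurable_itv _); rewrite setTI.
  by congr measurable; apply/seteqP; split => x /=; rewrite in_itv.
apply: (@eq_integrable _ _ _ mu _ mA (EFin \o f)).
  by move=> x; rewrite inE/= => /andP[x0 x1]; rewrite /f sE.
pose F x := s * ((s * (x - a)) `^ (q + 1) / (q + 1)).
have hl x : is_derive x 1 (fun t => s * (t - a)) s.
  by apply: is_derive_eq; rewrite subr0; exact: mulr1.
pose l n := if s == 1 then a + eps n else a - 1.
pose r n := if s == 1 then a + 1 else a - eps n.
have s1 : (-1 == 1 :> R) = false by apply/eqP; lra.
apply: (@integrable_exhaustion f F l r _ ((q + 1)^-1)).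
- by move=> n; rewrite /l /r; case: eqP => _; have := eps_lt1 n; lra.
- by move=> n; rewrite /l; case: eqP => // _; have := eps_le n; lra.
- by move=> n; rewrite /r; case: eqP => // _; have := eps_le n; lra.
- apply/seteqP; split => x /=.
    move=> /andP[x0 x1]; have [n hn] : exists n, eps n <= s * (x - a).
      exists (Num.truncn (s * (x - a))^-1); rewrite /eps -[leRHS]invrK lef_pV2 ?posrE ?invr_gt0//.
      by apply: ltW; apply: lt_trans (truncnS_gt _) _; rewrite ltr_nat.
    by exists n => //=; rewrite in_itv/= /l /r; case: hs hn x0 x1 => ->; rewrite ?eqxx ?s1; lra.
  move=> [n _] /=; rewrite in_itv/= /l /r; have := eps_gt0 n.
  by case: hs => ->; rewrite ?eqxx ?s1; lra.
- by rewrite /f; measurability.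
- by move=> x; exact: powR_ge0.
- move=> x /andP[x0 x1].
  apply: (is_derive1_eq (is_derive1M (is_derive1_cst x s)
    (is_derive1M (is_derive1_powR' (q + 1) (hl x) x0) (is_derive1_cst x _)))).
  rewrite addrK mul0r add0r mulr0 addr0 /f.
  transitivity (s * s * (s * (x - a)) `^ q); last by rewrite ss mul1r.
  by field; exact: lt0r_neq0.
- move=> x /andP[x0 x1].
  exact: (@is_derive1_continuous _ x _ (is_derive1_powR' q (hl x) x0)).
- move=> n; rewrite /F /l /r.
  have h1 x : 0 <= x `^ (q + 1) / (q + 1) by rewrite divr_ge0 ?powR_ge0 ?ltW.
  case: hs => ->; rewrite ?eqxx ?s1.
    rewrite (_ : 1 * (a + 1 - a) = 1); last by ring.
    by rewrite powR1 !mul1r gerBl.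
  rewrite (_ : -1 * (a - 1 - a) = 1); last by ring.
  by rewrite powR1 !mulN1r opprK mul1r gerDr oppr_le0.
Qed.

Lemma integrable_gauss (a : R) :
  mu.-integrable setT (fun x => (expR (- ((x - a) ^+ 2 / 4)))%:E).
Proof.
have s0 : Num.sqrt 2 != 0 :> R by rewrite gt_eqF// sqrtr_gt0.
have := integrableZl measurableT (normal_peak (Num.sqrt 2))^-1 (integrable_normal_pdf a (Num.sqrt 2)).
apply: eq_integrable => // x _; rewrite normal_pdfE// -EFinM mulKf; last first.
  by rewrite gt_eqF// normal_peak_gt0.
rewrite /normal_fun sqr_sqrtr//; congr (expR _)%:E.
by rewrite [2 *+ 2](_ : _ = 4) ?mulNr// mulr2n; ring.
Qed.

(** Near a the power is integrable; away from a it is at most 1, because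
q <= 0, and the Gaussian takes over. *)
Lemma integrable_gauss_powR (a q : R) : -1 < q <= 0 ->
  mu.-integrable setT (fun x => (`|x - a| `^ q * expR (- ((x - a) ^+ 2 / 4)))%:E).
Proof.
move=> /andP[q1 q0].
have mS s : measurable [set x : R | 0 < s * (x - a) <= 1].
  have ms : measurable_fun setT (fun x : R => s * (x - a)) by measurability.
  have := ms measurableT `]0, 1]%classic (measurable_itv _); rewrite setTI.
  by congr measurable; apply/seteqP; split => x /=; rewrite in_itv.
have {}mS s : measurable ([set x : R | 0 < s * (x - a) <= 1] : set (measurableTypeR R)) := mS s.
have i1 := @integrable_powR_side 1 a q (or_introl erefl) q1.
have i2 := @integrable_powR_side (-1) a q (or_intror erefl) q1.
have {}i1 := (integrable_mkcond _ (mS 1)).1 i1.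
have {}i2 := (integrable_mkcond _ (mS (-1))).1 i2.
apply: le_integrable (integrableD measurableT (integrableD measurableT i1 i2) (integrable_gauss a)) => //.
  by apply/measurable_EFinP; measurability.
move=> x _ /=; have g1 : expR (- ((x - a) ^+ 2 / 4)) <= 1.
  by rewrite expR_le1 oppr_le0 divr_ge0 ?sqr_ge0.
have g0 : 0 <= expR (- ((x - a) ^+ 2 / 4)) := expR_ge0 _.
have p0 : 0 <= `|x - a| `^ q := powR_ge0 _ _.
set A := [set x | _]; set A' := [set x | _].
have patch (B : set R) : (((fun x => (`|x - a| `^ q)%:E) \_ B) x =
   (if x \in B then `|x - a| `^ q else 0)%:E)%E by rewrite patchE; case: ifP.
rewrite (patch A) (patch A') -!EFinD lee_fin [leLHS]ger0_norm ?mulr_ge0//.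
rewrite [leRHS]ger0_norm; last by rewrite !addr_ge0//; case: ifP.
case: ifPn => [_|/negP nA].
  apply: (@le_trans _ _ (`|x - a| `^ q)); first by rewrite ler_piMr.
  by rewrite -addrA lerDl addr_ge0//; case: ifP.
case: ifPn => [_|/negP nA'].
  by apply: (@le_trans _ _ (`|x - a| `^ q)); rewrite ?ler_piMr// add0r lerDl.
rewrite !add0r ler_piMl//.
have [xa|xa] := eqVneq x a.
  rewrite xa subrr normr0; have [->|q0'] := eqVneq q 0; first by rewrite powRr0.
  by rewrite powR0.
have x1 : 1 <= `|x - a|.
  rewrite leNgt; apply/negP => h.
  have [xa'|xa'] := ltP a x.
    by apply: nA; rewrite inE /A /= mul1r subr_gt0 xa'/= (le_trans (ler_norm _))// ltW.
  apply: nA'; rewrite inE /A' /= mulN1r opprB subr_gt0 lt_neqAle xa xa' /=.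
  by rewrite (le_trans (ler_norm _))// distrC ltW.
by have := ler_powR x1 q0; rewrite powRr0.
Qed.

(** Decay of F like 1/|x| makes the boundary terms over growing symmetric
segments vanish in the limit. *)
Lemma integral_derive_eq0 f F C : (forall x, is_derive x 1 F (f x)) ->
  continuous f -> mu.-integrable setT (EFin \o f) ->
  (forall x, `|F x| * `|x| <= C) -> (\int[mu]_x (f x)%:E)%E = 0%E.
Proof.
move=> dF cf fi FC.
pose I n := `[- n.+1%:R, n.+1%:R]%classic : set R.
have mI n : measurable (I n : set (measurableTypeR R)) by exact: measurable_itv.
pose fn n := (EFin \o f) \_ (I n).
have mf := measurable_int _ fi.
have [_ _ cv] : [/\ mu.-integrable setT (EFin \o f),
    (\int[mu]_x `|fn n x - (EFin \o f) x| @[n --> \oo] --> 0)%E &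
    (\int[mu]_x fn n x @[n --> \oo] --> \int[mu]_x (EFin \o f) x)%E].
  apply: (@dominated_convergence _ _ _ mu _ _ fn (EFin \o f) (abse \o (EFin \o f))) => //.
  - move=> n; apply/(measurable_restrictT _ (mI n)); exact: measurable_funS mf.
  - apply: aeW => x _; apply: (@cvg_near_cst _ _ _ _ _).
    exists (Num.truncn `|x|) => // n /= hn; rewrite /fn patchE mem_set// /I/= in_itv/= -ler_norml.
    by rewrite (le_trans (ltW (truncnS_gt _)))// ler_nat.
  - exact: integrable_abse.
  - apply: aeW => x n _; rewrite /fn patchE; case: ifP => // _.
    by rewrite abse0 abse_ge0.
have E n : (\int[mu]_x fn n x = (F n.+1%:R - F (- n.+1%:R))%:E)%E.
  rewrite /fn -integral_mkcond; apply: FTC_is_derive => //.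
  by rewrite -subr_gt0 opprK addr_gt0.
  by move=> x _; exact: cf.
have cv0 : (\int[mu]_x fn n x @[n --> \oo] --> 0)%E.
  under eq_fun do rewrite E.
  apply: cvg_EFin; first by apply: nearW.
  have Fn n : `|F n.+1%:R - F (- n.+1%:R)| <= 2 * C * n.+1%:R^-1.
    rewrite ler_pdivlMr// (le_trans (ler_wpM2r _ (ler_normB _ _)))// mulrDl.
    have := FC n.+1%:R; have := FC (- n.+1%:R); rewrite normrN !normr_nat; lra.
  apply: norm_cvg0; apply: (@squeeze_cvgr _ _ _ _ (cst 0) (fun n => 2 * C * n.+1%:R^-1)).
  - by apply: nearW => n /=; rewrite normr_ge0 Fn.
  - exact: cvg_cst.
  - rewrite -[X in _ --> X](mulr0 (2 * C)); apply: cvgMr; exact: cvg_harmonic.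
exact: (cvg_unique _ cv cv0).
Qed.

End OneDim.

(** * Integrability in the plane against the weight *)

Section Plane.
Variable R : realType.
Local Notation leb := (@lebesgue_measure R).
Local Notation mu := (leb \x leb)%E.
Local Open Scope classical_set_scope.
Implicit Types (f g : R * R -> R).

Lemma integrable_tensor (f1 f2 : R -> R) : (forall x, 0 <= f1 x) -> (forall x, 0 <= f2 x) ->
  leb.-integrable setT (EFin \o f1) -> leb.-integrable setT (EFin \o f2) ->
  mu.-integrable setT (fun z => (f1 z.1 * f2 z.2)%:E).
Proof.
move=> f10 f20 i1 i2.
have m1 : measurable_fun setT f1 by apply/measurable_EFinP; exact: measurable_int i1.
have m2 : measurable_fun setT f2 by apply/measurable_EFinP; exact: measurable_int i2.
have mf : measurable_fun setT (fun z : R * R => f1 z.1 * f2 z.2).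
  apply: measurable_realM; first exact: (measurableT_comp (f := f1)).
  exact: (measurableT_comp (f := f2)).
apply/integrable12ltyP; first exact/measurable_EFinP.
have -> : (\int[leb]_x \int[leb]_y `|(f1 x * f2 y)%:E| =
  (\int[leb]_x (f1 x)%:E) * (\int[leb]_y (f2 y)%:E))%E.
  rewrite -ge0_integralZr//; last by apply: integral_ge0 => y _; rewrite lee_fin.
  - apply: eq_integral => x _; rewrite -ge0_integralZl//.
    + by apply: eq_integral => y _; rewrite -EFinM abse_EFin ger0_norm// mulr_ge0.
    + exact/measurable_EFinP.
    + by move=> y _; rewrite lee_fin.
    + by rewrite lee_fin.
  - exact/measurable_EFinP.
  - by move=> x _; rewrite lee_fin.
rewrite lte_mul_pinfty//; first by apply: integral_ge0 => y _; rewrite lee_fin.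
  exact: integrable_fin_num.
by have /integrableP[_] := i2; under eq_integral do rewrite /= ger0_norm//.
Qed.

Lemma null_vline (a : R) : mu ([set a] `*` setT) = 0%E.
Proof.
rewrite product_measure1E//.
by rewrite [X in (X * _)%E](_ : _ = 0%E) ?mul0e//; exact: lebesgue_measure_set1.
Qed.

Lemma null_hline (b : R) : mu (setT `*` [set b]) = 0%E.
Proof.
rewrite product_measure1E//.
by rewrite [X in (_ * X)%E](_ : _ = 0%E) ?mule0//; exact: lebesgue_measure_set1.
Qed.

(** Domination is only required off two axis-parallel lines, where a product
of one-variable singularities is finite. *)
Lemma integrable_off_lines (a b : R) f g : measurable_fun setT f ->
  mu.-integrable setT (EFin \o g) ->
  (forall z, z.1 != a -> z.2 != b -> `|f z| <= g z) ->
  mu.-integrable setT (EFin \o f).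
Proof.
move=> mf ig fg.
pose N := ([set a] `*` setT) `|` (setT `*` [set b]) : set (measurableTypeR R * measurableTypeR R).
have mN1 : measurable ([set a] `*` setT : set (measurableTypeR R * measurableTypeR R)).
  by apply: measurableX => //; exact: measurable_set1.
have mN2 : measurable (setT `*` [set b] : set (measurableTypeR R * measurableTypeR R)).
  by apply: measurableX => //; exact: measurable_set1.
have mN : measurable N by exact: measurableU.
have N0 : mu N = 0%E.
  apply/eqP; rewrite eq_le measure_ge0 andbT.
  apply: le_trans (measureU2 _ mN1 mN2) _.
  rewrite [X in (X + _ <= _)%E](_ : _ = 0%E); last exact: null_vline.
  by rewrite [X in (_ + X <= _)%E](_ : _ = 0%E) ?adde0//; exact: null_hline.
have mf' : measurable_fun setT (EFin \o f) by exact/measurable_EFinP.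
apply/(negligible_integrable mN measurableT mf' N0).
apply: (@le_integrable _ _ _ mu _ _ _ (EFin \o g)).
- exact: measurableD.
- exact: measurable_funTS.
- move=> [x y] [_ /=] /not_orP[/= h1 h2]; rewrite lee_fin; apply: (le_trans (fg _ _ _)) => /=.
  + by apply/eqP => e; apply: h1; split.
  + by apply/eqP => e; apply: h2; split.
  + exact: ler_norm.
- by apply: (integrableS _ _ _ ig) => //; exact: measurableD.
Qed.

Section Weight.
Variables (a c nu : R).
Hypotheses (c_gt : -1 < c) (nu_ge1 : 1 <= nu).

Definition dist2 (z : R * R) := (z.1 - a) ^+ 2 + z.2 ^+ 2.
(** The centre b of the Gaussian is 0 for the weight of the theorem and a for
the weight under which X - a times differentiation is symmetric. *)
Definition wt (b : R) (z : R * R) :=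
  dist2 z `^ c * expR (- (nu * ((z.1 - b) ^+ 2 + z.2 ^+ 2))).

Lemma dist2_ge0 z : 0 <= dist2 z.
Proof. by rewrite addr_ge0 ?sqr_ge0. Qed.
Lemma wt_ge0 b z : 0 <= wt b z.
Proof. by rewrite mulr_ge0 ?powR_ge0 ?expR_ge0. Qed.

Lemma measurable_wt b : measurable_fun setT (wt b).
Proof. by rewrite /wt /dist2; measurability. Qed.

(** Growth below exp(e |z - a|^2) for every e > 0: stable under sums and
products, shared by polynomials and by exponentials of linear growth, and
enough for integrability against the weight. *)
Definition subgauss f := forall e, 0 < e ->
  exists2 C, 0 <= C & forall z, `|f z| <= C * expR (e * dist2 z).

Lemma subgaussD f g : subgauss f -> subgauss g -> subgauss (fun z => f z + g z).
Proof.
move=> hf hg e e0; have [C C0 hC] := hf e e0; have [D D0 hD] := hg e e0.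
exists (C + D) => [|z]; first exact: addr_ge0.
by rewrite mulrDl (le_trans (ler_normD _ _))// lerD.
Qed.
Lemma subgaussM f g : subgauss f -> subgauss g -> subgauss (fun z => f z * g z).
Proof.
move=> hf hg e e0; have e20 : 0 < e / 2 by rewrite divr_gt0.
have [C C0 hC] := hf _ e20; have [D D0 hD] := hg _ e20.
exists (C * D) => [|z]; first exact: mulr_ge0.
rewrite normrM [e in expR (e * _)]splitr mulrDl expRD mulrACA.
by rewrite ler_pM.
Qed.
Lemma subgauss_le f g : subgauss g -> (forall z, `|f z| <= `|g z|) -> subgauss f.
Proof.
move=> hg fg e e0; have [D D0 hD] := hg e e0.
by exists D => // z; exact: le_trans (fg z) (hD z).
Qed.
Lemma subgaussN f : subgauss f -> subgauss (fun z => - f z).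
Proof. by move=> hf; apply: subgauss_le hf _ => z; rewrite normrN. Qed.
Lemma subgauss_norm f : subgauss f -> subgauss (fun z => `|f z|).
Proof. by move=> hf; apply: subgauss_le hf _ => z; rewrite normr_id. Qed.
Lemma subgauss_cst k : subgauss (fun=> k).
Proof.
move=> e e0; exists `|k| => // z; rewrite ler_peMr// -expR0 ler_expR.
by rewrite mulr_ge0 ?dist2_ge0 ?ltW.
Qed.
Lemma subgauss_dist2 : subgauss dist2.
Proof.
move=> e e0; exists e^-1 => [|z]; first by rewrite invr_ge0 ltW.
rewrite ger0_norm ?dist2_ge0// ler_pdivlMl// (le_trans _ (expR_ge1Dx _))//.
by rewrite lerDr.
Qed.
Lemma subgauss_fst : subgauss fst.
Proof.
apply: (subgauss_le (g := fun z => (`|a| + 1) + dist2 z)).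
  by apply: subgaussD; [exact: subgauss_cst|exact: subgauss_dist2].
move=> z /=; rewrite [leRHS]ger0_norm; last by rewrite addr_ge0 ?dist2_ge0// addr_ge0.
apply: (@le_trans _ _ (`|a| + `|z.1 - a|)).
  by rewrite -[z.1 in leLHS](subrK a) addrC ler_normD.
rewrite -addrA lerD2l /dist2.
move: (z.1 - a) (z.2) => x y.
have := sqr_ge0 (`|x| - 1); rewrite sqrrB1 real_normK ?num_real//.
have := sqr_ge0 y; have := normr_ge0 x; have := sqr_ge0 x; lra.
Qed.
Lemma subgauss_snd : subgauss snd.
Proof.
apply: (subgauss_le (g := fun z => 1 + dist2 z)).
  by apply: subgaussD; [exact: subgauss_cst|exact: subgauss_dist2].
move=> z /=; rewrite [leRHS]ger0_norm; last by rewrite addr_ge0 ?dist2_ge0.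
rewrite /dist2; move: (z.1 - a) (z.2) => x y.
have := sqr_ge0 (`|y| - 1); rewrite sqrrB1 real_normK ?num_real//.
have := sqr_ge0 x; have := normr_ge0 y; have := sqr_ge0 y; lra.
Qed.

Let c0 := Num.min c 0.

(** With c0 = min(c, 0): for c >= 0 the power is absorbed by the exponential,
and for c < 0 it decreases, so s may be replaced by a smaller m. *)
Lemma powR_le_exp (e : R) : 0 < e -> exists2 C, 0 <= C &
  forall s m, 0 < m -> m <= s -> s `^ c <= C * m `^ c0 * expR (e * s).
Proof.
have powE s q : 0 < s -> s `^ q = expR (q * ln s) :> R by move=> s0; rewrite /powR gt_eqF.
move=> e0; rewrite /c0 minElt; case: (ltP c 0) => [cn|cp].
  exists 1 => // s m m0 ms; have s0 : 0 < s := lt_le_trans m0 ms.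
  rewrite mul1r -[leLHS]mulr1 ler_pM ?powR_ge0//; last first.
    by rewrite -expR0 ler_expR mulr_ge0// ltW.
  by rewrite !powE// ler_expR ler_nM2l// ler_ln ?posrE.
exists (expR (- (c * ln (e / (c + 1))))) => [|s m m0 ms]; first exact: expR_ge0.
have s0 : 0 < s := lt_le_trans m0 ms.
have c1 : 0 < c + 1 by lra.
have ec : 0 < e / (c + 1) by rewrite divr_gt0.
rewrite powRr0 mulr1 powE// -expRD ler_expR.
have h : ln (s * (e / (c + 1))) <= s * (e / (c + 1)).
  have := expR_ge1Dx (ln (s * (e / (c + 1)))).
  by rewrite lnK ?posrE ?(mulr_gt0 s0 ec)// => hh; apply: le_trans hh; rewrite lerDr.
rewrite lnM ?posrE// in h.
have h2 : c * (s * (e / (c + 1))) <= e * s.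
  have -> : c * (s * (e / (c + 1))) = c / (c + 1) * (e * s) by ring.
  apply: ler_piMl; first by rewrite mulr_ge0// ltW.
  by rewrite ler_pdivrMr//; lra.
have := ler_wpM2l cp h; lra.
Qed.

(** Where m is a product of one-variable functions, this separates the
variables in the singular factor, see [integrable_wt]. *)
Lemma wt_le b : exists2 C, 0 <= C & forall z m, 0 < m -> m <= dist2 z ->
  wt b z <= C * m `^ c0 * expR (- (3 / 8 * dist2 z)).
Proof.
have e8 : 0 < 8^-1 :> R by rewrite invr_gt0.
(* The Gaussian provides exp(- dist2 / 2); an eighth of dist2 is spent here on
   the power, and another eighth is later left to the subgaussian factor. *)
have [C C0 hC] := powR_le_exp e8.
exists (C * expR (nu * (a - b) ^+ 2)) => [|z m m0 ms].
  by rewrite mulr_ge0 ?expR_ge0.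
have h1 := hC _ _ m0 ms; rewrite /wt.
have h2 : expR (- (nu * ((z.1 - b) ^+ 2 + z.2 ^+ 2))) <=
   expR (nu * (a - b) ^+ 2) * expR (- (2^-1 * dist2 z)).
  rewrite -expRD ler_expR /dist2.
  have : nu * ((z.1 - a) ^+ 2 / 2 + z.2 ^+ 2 - (a - b) ^+ 2) <=
         nu * ((z.1 - b) ^+ 2 + z.2 ^+ 2).
    apply: ler_wpM2l; first exact: le_trans ler01 nu_ge1.
    rewrite (_ : z.1 - b = (z.1 - a) + (a - b)); last by ring.
    by move: (z.1 - a) (a - b) => x y; have := sqr_ge0 (x + 2 * y); lra.
  have : 1 * ((z.1 - a) ^+ 2 / 2 + z.2 ^+ 2) <= nu * ((z.1 - a) ^+ 2 / 2 + z.2 ^+ 2).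
    by rewrite ler_wpM2r// addr_ge0 ?divr_ge0 ?sqr_ge0.
  have := sqr_ge0 z.2; lra.
apply: le_trans (ler_pM (powR_ge0 _ _) (expR_ge0 _) h1 h2) _.
rewrite le_eqVlt; apply/orP; left; apply/eqP.
rewrite (_ : - (3 / 8 * dist2 z) = 8^-1 * dist2 z - 2^-1 * dist2 z); last by field.
by rewrite expRD; ring.
Qed.

(** As |x - a| |y| <= |z - a|^2, the weight is dominated off the lines through a
by the product of |x - a|^c0 and |y|^c0 with Gaussians, and c0 = min(c, 0) > -1
makes both factors integrable. *)
Lemma integrable_wt b f g : measurable_fun setT f -> subgauss g ->
  (forall z, `|f z| <= g z * wt b z) -> mu.-integrable setT (EFin \o f).
Proof.
move=> mf hg fg.
have e8 : 0 < 8^-1 :> R by rewrite invr_gt0.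
have [C C0 hC] := wt_le b; have [D D0 hD] := hg _ e8.
have c01 : -1 < c0 <= 0 by rewrite /c0 lt_min c_gt ge_min lexx orbT; lra.
pose G (d x : R) := `|x - d| `^ c0 * expR (- ((x - d) ^+ 2 / 4)).
have G0 d x : 0 <= G d x by rewrite mulr_ge0 ?powR_ge0 ?expR_ge0.
have iG := integrable_tensor (G0 a) (G0 0) (integrable_gauss_powR a c01) (integrable_gauss_powR 0 c01).
apply: (@integrable_off_lines a 0 f (fun z => C * D * (G a z.1 * G 0 z.2))) => //.
  exact: (integrableZl measurableT (C * D) iG).
move=> z z1 z2; apply: (le_trans (fg z)).
set m := `|z.1 - a| * `|z.2 - 0|.
have m0 : 0 < m by rewrite mulr_gt0 ?normr_gt0 ?subr0// subr_eq0.
have mz : m <= dist2 z.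
  rewrite /m subr0 /dist2 -[X in _ <= X + _]real_normK ?num_real//.
  rewrite -[X in _ <= _ + X]real_normK ?num_real//.
  move: `|z.1 - a| `|z.2| (normr_ge0 (z.1 - a)) (normr_ge0 z.2) => x y x0 y0.
  by have := sqr_ge0 (x - y); have := sqr_ge0 (x + y); lra.
apply: le_trans (ler_wpM2r (wt_ge0 _ _) (ler_norm _)) _.
apply: le_trans (ler_pM (normr_ge0 _) (wt_ge0 _ _) (hD z) (hC z m m0 mz)) _.
rewrite le_eqVlt; apply/orP; left; apply/eqP.
rewrite /G /m powRM// mulrACA.
transitivity (C * D * (`|z.1 - a| `^ c0 * `|z.2 - 0| `^ c0) *
    (expR (8^-1 * dist2 z) * expR (- (3 / 8 * dist2 z)))).
  by ring.
rewrite -expRD (_ : 8^-1 * dist2 z - 3 / 8 * dist2 z = - ((z.1 - a) ^+ 2 / 4) - ((z.2 - 0) ^+ 2 / 4)).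
  by rewrite expRD; ring.
by rewrite subr0 /dist2; field.
Qed.

End Weight.

End Plane.

(** * Integration by parts in the plane *)

Section PlaneParts.
Variable R : realType.
Local Notation leb := (@lebesgue_measure R).
Local Notation mu := (leb \x leb)%E.
Local Open Scope classical_set_scope.

(** The singularity lies on the line y = 0, which Fubini lets one discard. *)
Lemma integral_dx_eq0 (F f : R * R -> R) :
  mu.-integrable setT (EFin \o f) ->
  (forall y : R, y != 0 -> forall x : R, is_derive x 1 (fun x : R => F (x, y)) (f (x, y))) ->
  (forall y : R, y != 0 -> continuous (fun x : R => f (x, y))) ->
  (forall y : R, y != 0 -> exists C, forall x, `|F (x, y)| * `|x| <= C) ->
  (\int[mu]_z (f z)%:E)%E = 0%E.
Proof.
move=> fi dF cf FC; rewrite -(integral21_prod_meas1 fi).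
have ae2 := ae_integrable2 fi.
transitivity (\int[leb]_y (cst 0 y : \bar R))%E; last by rewrite integral0.
apply: ae_eq_integral => //; first exact: (measurable_fubini_G fi).
have y0 : {ae leb, forall y : R, y != 0}.
  exists [set 0]; split => //; first exact: lebesgue_measure_set1.
  by move=> y /= /negP; rewrite negbK => /eqP.
apply: filterS2 ae2 y0 => y fy y0 _ /=; rewrite /fubini_G.
have [C hC] := FC y y0.
exact: (integral_derive_eq0 (dF y y0) (cf y y0) fy hC).
Qed.

Lemma integral_dy_eq0 a (F f : R * R -> R) :
  mu.-integrable setT (EFin \o f) ->
  (forall x : R, x != a -> forall y : R, is_derive y 1 (fun y : R => F (x, y)) (f (x, y))) ->
  (forall x : R, x != a -> continuous (fun y : R => f (x, y))) ->
  (forall x : R, x != a -> exists C, forall y, `|F (x, y)| * `|y| <= C) ->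
  (\int[mu]_z (f z)%:E)%E = 0%E.
Proof.
move=> fi dF cf FC; rewrite -(integral12_prod_meas1 fi).
have ae1 := ae_integrable1 fi.
transitivity (\int[leb]_y (cst 0 y : \bar R))%E; last by rewrite integral0.
apply: ae_eq_integral => //; first exact: (measurable_fubini_F fi).
have xa : {ae leb, forall x : R, x != a}.
  exists [set a]; split => //; first exact: lebesgue_measure_set1.
  by move=> y /= /negP; rewrite negbK => /eqP.
apply: filterS2 ae1 xa => x fx xa _ /=; rewrite /fubini_F.
have [C hC] := FC x xa.
exact: (integral_derive_eq0 (dF x xa) (cf x xa) fx hC).
Qed.

Lemma is_derive1_subr (x k : R) : is_derive x 1 (fun x : R => x - k) (1 : R).
Proof.
apply: (is_derive1_eq (is_derive1D (is_derive1_id x) (is_derive1_cst x (- k)))).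
by rewrite addr0.
Qed.

Lemma sqr_dist_dx (k x y : R) :
  is_derive x 1 (fun x : R => (x - k) ^+ 2 + y ^+ 2) (2 * (x - k)).
Proof.
have dk := is_derive1_subr x k.
by apply: (is_derive1_eq (is_derive1D (is_derive1M dk dk) (is_derive1_cst x (y ^+ 2)))); ring.
Qed.

Lemma sqr_dist_dy (k x y : R) :
  is_derive y 1 (fun y : R => (x - k) ^+ 2 + y ^+ 2) (2 * y).
Proof.
have dy := is_derive1_id y.
apply: (is_derive1_eq (is_derive1D (is_derive1_cst y ((x - k) ^+ 2)) (is_derive1M dy dy))).
by ring.
Qed.

Section Weighted.
Variables (a c nu b : R).
Hypotheses (c_gt : -1 < c) (nu_ge1 : 1 <= nu).
Local Notation dist2 := (dist2 a).
Local Notation wt := (wt a c nu b).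
Local Notation subgauss := (subgauss a).

(** A line missing a keeps a positive distance to a; T wt is bounded there, which
with T times a coordinate in place of T gives the decay that
[integral_derive_eq0] asks for. *)
Lemma wt_line_bound (T : R * R -> R) (m : R) : subgauss T -> 0 < m ->
  exists C, forall z, m <= dist2 z -> `|T z * wt z| <= C.
Proof.
move=> hT m0; have e8 : 0 < 8^-1 :> R by rewrite invr_gt0.
have [D D0 hD] := hT _ e8; have [C C0 hC] := @wt_le R a c nu nu_ge1 b.
exists (D * (C * m `^ Num.min c 0)) => z mz.
rewrite normrM [X in _ * X]ger0_norm ?wt_ge0//.
apply: le_trans (ler_pM (normr_ge0 _) (wt_ge0 _ _ _ _ _) (hD z) (hC z m m0 mz)) _.
rewrite [leLHS](_ : _ = D * (C * m `^ Num.min c 0) *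
  (expR (8^-1 * dist2 z) * expR (- (3 / 8 * dist2 z)))); last by ring.
rewrite -expRD ler_piMr ?mulr_ge0 ?powR_ge0//.
rewrite -[leRHS]expR0 ler_expR [leLHS](_ : _ = - (4^-1 * dist2 z)); last by field.
by rewrite oppr_le0 mulr_ge0 ?dist2_ge0// invr_ge0.
Qed.

Lemma wt_dx (x y : R) : 0 < dist2 (x, y) -> is_derive x 1 (fun x : R => wt (x, y))
  ((2 * c * (x - a) / dist2 (x, y) - 2 * nu * (x - b)) * wt (x, y)).
Proof.
move=> s0.
have sq k := sqr_dist_dx k x y.
have d2 : is_derive x 1 (fun x : R => - (nu * ((x - b) ^+ 2 + y ^+ 2))) (- (2 * nu * (x - b))).
  by apply: (is_derive1_eq (is_derive1N (is_derive1M (is_derive1_cst x nu) (sq b)))); ring.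
apply: (is_derive1_eq (is_derive1M (is_derive1_powR' c (sq a) s0) (is_derive1_expR d2))).
rewrite powRB; last by apply/implyP => _; exact: lt0r_neq0.
by rewrite powRr1 ?(ltW s0)// /wt /=; rewrite /dist2 /= in s0 *; field; exact: lt0r_neq0.
Qed.

Lemma wt_dy (x y : R) : 0 < dist2 (x, y) -> is_derive y 1 (fun y : R => wt (x, y))
  ((2 * c * y / dist2 (x, y) - 2 * nu * y) * wt (x, y)).
Proof.
move=> s0.
have sq k := sqr_dist_dy k x y.
have d2 : is_derive y 1 (fun y : R => - (nu * ((x - b) ^+ 2 + y ^+ 2))) (- (2 * nu * y)).
  by apply: (is_derive1_eq (is_derive1N (is_derive1M (is_derive1_cst y nu) (sq b)))); ring.
apply: (is_derive1_eq (is_derive1M (is_derive1_powR' c (sq a) s0) (is_derive1_expR d2))).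
rewrite powRB; last by apply/implyP => _; exact: lt0r_neq0.
by rewrite powRr1 ?(ltW s0)// /wt /=; rewrite /dist2 /= in s0 *; field; exact: lt0r_neq0.
Qed.

Lemma dist2_gt0_y (x y : R) : y != 0 -> 0 < y ^+ 2 <= dist2 (x, y).
Proof. by move=> y0; rewrite /dist2 /= exprn_even_gt0//= y0/= lerDr sqr_ge0. Qed.
Lemma dist2_gt0_x (x y : R) : x != a -> 0 < (x - a) ^+ 2 <= dist2 (x, y).
Proof. by move=> x0; rewrite /dist2 /= exprn_even_gt0//= subr_eq0 x0/= lerDl sqr_ge0. Qed.

Lemma continuousM_line (f g : R -> R) : continuous f -> continuous g -> continuous (fun t => f t * g t).
Proof. by move=> cf cg t; apply: cvgM; [exact: cf|exact: cg]. Qed.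

(** H wt is the x-derivative of T wt.  The bound by G says that T vanishes
at a to first order, which keeps the term with the factor 1 / dist2 below the
weight times G. *)
Lemma integral_wt_dx (T Tx G H : R * R -> R) :
  measurable_fun setT Tx -> measurable_fun setT T ->
  subgauss T -> subgauss Tx -> subgauss G ->
  (forall z, `|T z * (z.1 - a) / dist2 z| <= G z) ->
  (forall x y : R, is_derive x 1 (fun x : R => T (x, y)) (Tx (x, y))) ->
  (forall y : R, continuous (fun x : R => Tx (x, y))) ->
  (forall z, H z = Tx z + 2 * c * (T z * (z.1 - a) / dist2 z) - 2 * nu * (T z * (z.1 - b))) ->
  mu.-integrable setT (fun z => (H z * wt z)%:E) /\
  (\int[mu]_z (H z * wt z)%:E)%E = 0%E.
Proof.
move=> mTx mT sT sTx sG TG dT cTx HE.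
have mH : measurable_fun setT (fun z => H z * wt z).
  apply: measurable_realM; last exact: measurable_wt.
  rewrite (funext HE).
  have mi : measurable_fun setT (fun z => (dist2 z)^-1).
    under eq_fun do rewrite -powR_inv1 ?dist2_ge0//.
    by rewrite /dist2; measurability.
  by measurability.
have sH : subgauss (fun z => `|Tx z| + `|2 * c| * G z + `|2 * nu| * `|T z * (z.1 - b)|).
  apply: subgaussD; first apply: subgaussD; first exact: subgauss_norm.
    by apply: subgaussM => //; exact: subgauss_cst.
  apply: subgaussM; first exact: subgauss_cst.
  apply: subgauss_norm; apply: subgaussM => //; apply: subgaussD; last exact: subgauss_cst.
  exact: subgauss_fst.
have iH : mu.-integrable setT (fun z => (H z * wt z)%:E).
  apply: (@integrable_wt _ a c nu c_gt nu_ge1 b _ _ mH sH) => z.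
  rewrite normrM [X in _ * X]ger0_norm ?wt_ge0// ler_wpM2r ?wt_ge0// HE.
  apply: le_trans (ler_normB _ _) _; apply: lerD; last by rewrite normrM.
  apply: le_trans (ler_normD _ _) _; apply: lerD => //.
  by rewrite [leLHS]normrM; exact: ler_wpM2l.
split => //; apply: (@integral_dx_eq0 (fun z => T z * wt z)) => //.
- move=> y /dist2_gt0_y h x; have /andP[y0 ys] := h x.
  have s0 : 0 < dist2 (x, y) := lt_le_trans y0 ys.
  apply: (is_derive1_eq (is_derive1M (dT x y) (wt_dx s0))); rewrite HE /=.
  by field; exact: lt0r_neq0.
- move=> y /dist2_gt0_y h.
  have s0 x : 0 < dist2 (x, y) by have /andP[y0 ys] := h x; exact: lt_le_trans ys.
  have cw : continuous (fun x : R => wt (x, y)).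
    by move=> x; exact: is_derive1_continuous (wt_dx (s0 x)).
  have cT : continuous (fun x : R => T (x, y)).
    by move=> x; exact: is_derive1_continuous (dT x y).
  have cs : continuous (fun x : R => (dist2 (x, y))^-1).
    move=> x; apply: cvgV; first exact: lt0r_neq0.
    exact: is_derive1_continuous (sqr_dist_dx a x y).
  have cl k : continuous (fun x : R => x - k).
    by move=> x; exact: is_derive1_continuous (is_derive1_subr x k).
  apply: continuousM_line => //.
  under eq_fun do rewrite HE.
  move=> x; apply: cvgB; first (apply: cvgD; first exact: cTx).
    apply: cvgMr; exact: (continuousM_line (continuousM_line cT (cl a)) cs).
  by apply: cvgMr; exact: (continuousM_line cT (cl b)).
- move=> y /dist2_gt0_y h; have [C hC] := wt_line_bound (subgaussM sT (subgauss_fst a)) (andP (h 0)).1.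
  exists C => x; rewrite -normrM mulrAC; apply: hC.
  by have /andP[] := h x.
Qed.

Lemma integral_wt_dy (T Ty G H : R * R -> R) :
  measurable_fun setT Ty -> measurable_fun setT T ->
  subgauss T -> subgauss Ty -> subgauss G ->
  (forall z, `|T z * z.2 / dist2 z| <= G z) ->
  (forall x y : R, is_derive y 1 (fun y : R => T (x, y)) (Ty (x, y))) ->
  (forall x : R, continuous (fun y : R => Ty (x, y))) ->
  (forall z, H z = Ty z + 2 * c * (T z * z.2 / dist2 z) - 2 * nu * (T z * z.2)) ->
  mu.-integrable setT (fun z => (H z * wt z)%:E) /\
  (\int[mu]_z (H z * wt z)%:E)%E = 0%E.
Proof.
move=> mTy mT sT sTy sG TG dT cTy HE.
have mH : measurable_fun setT (fun z => H z * wt z).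
  apply: measurable_realM; last exact: measurable_wt.
  rewrite (funext HE).
  have mi : measurable_fun setT (fun z => (dist2 z)^-1).
    under eq_fun do rewrite -powR_inv1 ?dist2_ge0//.
    by rewrite /dist2; measurability.
  by measurability.
have sH : subgauss (fun z => `|Ty z| + `|2 * c| * G z + `|2 * nu| * `|T z * z.2|).
  apply: subgaussD; first apply: subgaussD; first exact: subgauss_norm.
    by apply: subgaussM => //; exact: subgauss_cst.
  apply: subgaussM; first exact: subgauss_cst.
  by apply: subgauss_norm; apply: subgaussM => //; exact: subgauss_snd.
have iH : mu.-integrable setT (fun z => (H z * wt z)%:E).
  apply: (@integrable_wt _ a c nu c_gt nu_ge1 b _ _ mH sH) => z.
  rewrite normrM [X in _ * X]ger0_norm ?wt_ge0// ler_wpM2r ?wt_ge0// HE.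
  apply: le_trans (ler_normB _ _) _; apply: lerD; last by rewrite normrM.
  apply: le_trans (ler_normD _ _) _; apply: lerD => //.
  by rewrite [leLHS]normrM; exact: ler_wpM2l.
split => //; apply: (@integral_dy_eq0 a (fun z => T z * wt z)) => //.
- move=> x /dist2_gt0_x h y; have /andP[y0 ys] := h y.
  have s0 : 0 < dist2 (x, y) := lt_le_trans y0 ys.
  apply: (is_derive1_eq (is_derive1M (dT x y) (wt_dy s0))); rewrite HE /=.
  by field; exact: lt0r_neq0.
- move=> x /dist2_gt0_x h.
  have s0 y : 0 < dist2 (x, y) by have /andP[y0 ys] := h y; exact: lt_le_trans ys.
  have cw : continuous (fun y : R => wt (x, y)).
    by move=> y; exact: is_derive1_continuous (wt_dy (s0 y)).
  have cT : continuous (fun y : R => T (x, y)).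
    by move=> y; exact: is_derive1_continuous (dT x y).
  have cs : continuous (fun y : R => (dist2 (x, y))^-1).
    move=> y; apply: cvgV; first exact: lt0r_neq0.
    exact: is_derive1_continuous (sqr_dist_dy a x y).
  have cl : continuous (fun y : R => y) by move=> y; exact: cvg_id.
  apply: continuousM_line => //.
  under eq_fun do rewrite HE.
  move=> y; apply: cvgB; first (apply: cvgD; first exact: cTy).
    apply: cvgMr; exact: (continuousM_line (continuousM_line cT cl) cs).
  by apply: cvgMr; exact: (continuousM_line cT cl).
- move=> x /dist2_gt0_x h; have [C hC] := wt_line_bound (subgaussM sT (subgauss_snd a)) (andP (h 0)).1.
  exists C => y; rewrite -normrM mulrAC; apply: hC.
  by have /andP[] := h y.
Qed.

End Weighted.
End PlaneParts.

(** * A limit for the exponential *)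

Section ExpLimit.
Variable R : realType.
Local Open Scope classical_set_scope.

(** Squeeze, from 1 + w <= exp(w) and 1 + w >= exp(w / (1 + w)); the argument
may depend on m, as in the application to |1 - kappa u / m|^2. *)
Lemma cvg_exp_sequence (v : nat -> R) (l : R) : v @ \oo --> l ->
  (1 + v m / m.+1%:R) ^+ m.+1 @[m --> \oo] --> expR l.
Proof.
move=> vl; pose w m := v m / m.+1%:R.
have w0 : w @ \oo --> (0 : R).
  by rewrite -(mulr0 l); apply: cvgM => //; exact: cvg_harmonic.
have w1 : (1 + w m) @[m --> \oo] --> (1 : R).
  by rewrite -[X in _ --> X](addr0 1); apply: cvgD => //; exact: cvg_cst.
have ce := @continuous_expR R.
apply: (@squeeze_cvgr _ _ _ _ (fun m => expR (v m / (1 + w m))) (fun m => expR (v m))).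
- near=> m.
  have wm : 0 < 1 + w m.
    near: m; apply: (cvgr_gt 1) => //; exact: w1.
  have vE : v m = m.+1%:R * w m by rewrite /w mulrC divfK.
  apply/andP; split; last first.
    by rewrite -/(w m) vE expRM_natl lerXn2r ?nnegrE ?expR_ge0 ?(ltW wm)// expR_ge1Dx.
  rewrite -/(w m) vE -[_ * _ / _]mulrA expRM_natl lerXn2r ?nnegrE ?expR_ge0 ?(ltW wm)//.
  have := expR_ge1Dx (- (w m / (1 + w m))).
  rewrite (_ : 1 - w m / (1 + w m) = (1 + w m)^-1); last by field; exact: lt0r_neq0.
  by rewrite expRN lef_pV2 ?posrE ?expR_gt0.
- apply: continuous_cvg; first exact: ce.
  rewrite -[X in _ --> X](divr1 l); apply: cvgM => //.
  by apply: cvgV => //; exact: oner_neq0.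
- by apply: continuous_cvg => //; exact: ce.
Unshelve. all: by end_near. Qed.
End ExpLimit.

(** * The weighted pairing of complex polynomials *)

Section PolyPlane.
Variable R : realType.
Local Notation leb := (@lebesgue_measure R).
Local Notation mu := (leb \x leb)%E.
Local Open Scope classical_set_scope.
Implicit Types (P Q S : {poly R[i]}) (z : R * R).

Definition pR P z := complex.Re P.[z.1 +i* z.2].
Definition pI P z := complex.Im P.[z.1 +i* z.2].

Lemma cReM (x y : R[i]) : complex.Re (x * y) =
  complex.Re x * complex.Re y - complex.Im x * complex.Im y.
Proof. by case: x y => [? ?] [? ?]. Qed.
Lemma cImM (x y : R[i]) : complex.Im (x * y) =
  complex.Re x * complex.Im y + complex.Im x * complex.Re y.
Proof. by case: x y => [? ?] [? ?]. Qed.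
Lemma cReD (x y : R[i]) : complex.Re (x + y) = complex.Re x + complex.Re y.
Proof. by case: x y => [? ?] [? ?]. Qed.
Lemma cImD (x y : R[i]) : complex.Im (x + y) = complex.Im x + complex.Im y.
Proof. by case: x y => [? ?] [? ?]. Qed.

Lemma pRM P Q z : pR (P * Q) z = pR P z * pR Q z - pI P z * pI Q z.
Proof. by rewrite /pR hornerM cReM. Qed.
Lemma pIM P Q z : pI (P * Q) z = pR P z * pI Q z + pI P z * pR Q z.
Proof. by rewrite /pI hornerM cImM. Qed.
Lemma pRD P Q z : pR (P + Q) z = pR P z + pR Q z.
Proof. by rewrite /pR hornerD cReD. Qed.
Lemma pID P Q z : pI (P + Q) z = pI P z + pI Q z.
Proof. by rewrite /pI hornerD cImD. Qed.
Lemma pRZ k P z : pR (k *: P) z = complex.Re k * pR P z - complex.Im k * pI P z.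
Proof. by rewrite /pR hornerZ cReM. Qed.
Lemma pIZ k P z : pI (k *: P) z = complex.Re k * pI P z + complex.Im k * pR P z.
Proof. by rewrite /pI hornerZ cImM. Qed.
Lemma pRX z : pR 'X z = z.1. Proof. by rewrite /pR hornerX. Qed.
Lemma pIX z : pI 'X z = z.2. Proof. by rewrite /pI hornerX. Qed.
Lemma pRC k z : pR k%:P z = complex.Re k. Proof. by rewrite /pR hornerC. Qed.
Lemma pIC k z : pI k%:P z = complex.Im k. Proof. by rewrite /pI hornerC. Qed.
Lemma pR1 z : pR 1 z = 1. Proof. exact: pRC. Qed.
Lemma pI1 z : pI 1 z = 0. Proof. exact: pIC. Qed.
Lemma pRu a P z : pR (('X - a%:C%:P) * P) z = (z.1 - a) * pR P z - z.2 * pI P z.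
Proof. by rewrite pRM -polyCN pRD pID pRX pIX pRC pIC /= oppr0 addr0. Qed.
Lemma pIu a P z : pI (('X - a%:C%:P) * P) z = (z.1 - a) * pI P z + z.2 * pR P z.
Proof. by rewrite pIM -polyCN pRD pID pRX pIX pRC pIC /= oppr0 addr0. Qed.

(** The real and imaginary parts of a polynomial are built from the coordinates
by ring operations. *)
Lemma pRI_ind (A : (R * R -> R) -> Prop) P :
  A fst -> A snd -> (forall k, A (fun=> k)) ->
  (forall f g, A f -> A g -> A (fun z => f z + g z)) ->
  (forall f g, A f -> A g -> A (fun z => f z * g z)) ->
  A (pR P) /\ A (pI P).
Proof.
move=> Ax Ay Ak AD AM; elim/poly_ind: P => [|P k [IHR IHI]].
  have -> : pR 0 = (fun=> 0) by apply/funext => z; rewrite -[0]/(0%:P) pRC.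
  have -> : pI 0 = (fun=> 0) by apply/funext => z; rewrite -[0]/(0%:P) pIC.
  by [].
have -> : pR (P * 'X + k%:P) = (fun z => pR P z * z.1 + (-1 * (pI P z * z.2)) + complex.Re k).
  by apply/funext => z; rewrite pRD pRM pRX pIX pRC; ring.
have -> : pI (P * 'X + k%:P) = (fun z => pR P z * z.2 + (pI P z * z.1) + complex.Im k).
  by apply/funext => z; rewrite pID pIM pRX pIX pIC; ring.
split.
  by apply: (AD) => //; apply: (AD); [apply: (AM)|apply: (AM) => //; apply: (AM)].
by apply: (AD) => //; apply: (AD); apply: (AM).
Qed.

Lemma measurable_pRI P : measurable_fun setT (pR P) /\ measurable_fun setT (pI P).
Proof.
apply: pRI_ind; [exact: measurable_fst | exact: measurable_snd| exact: measurable_real_cst|..].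
- exact: measurable_realD.
- exact: measurable_realM.
Qed.

Lemma subgauss_pRI a P : subgauss a (pR P) /\ subgauss a (pI P).
Proof.
apply: (pRI_ind (A := subgauss a)); [exact: subgauss_fst | exact: subgauss_snd| exact: subgauss_cst|..].
- exact: subgaussD.
- exact: subgaussM.
Qed.

Lemma pRI_dx P (x y : R) :
  is_derive x 1 (fun x : R => pR P (x, y)) (pR P^`() (x, y)) /\
  is_derive x 1 (fun x : R => pI P (x, y)) (pI P^`() (x, y)).
Proof.
elim/poly_ind: P => [|P k [IHR IHI]].
  rewrite deriv0 -[0]/(0%:P); split.
    by under eq_fun do rewrite pRC; rewrite pRC; exact: is_derive1_cst.
  by under eq_fun do rewrite pIC; rewrite pIC; exact: is_derive1_cst.
rewrite derivMXaddC; split.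
  under eq_fun do rewrite pRD pRM pRX pIX pRC.
  apply: (is_derive1_eq (is_derive1D (is_derive1D (is_derive1M IHR (is_derive1_id x))
    (is_derive1N (is_derive1M IHI (is_derive1_cst x y)))) (is_derive1_cst x (complex.Re k)))).
  by rewrite pRD pRM pRX pIX /=; ring.
under eq_fun do rewrite pID pIM pRX pIX pIC.
apply: (is_derive1_eq (is_derive1D (is_derive1D (is_derive1M IHR (is_derive1_cst x y))
    (is_derive1M IHI (is_derive1_id x))) (is_derive1_cst x (complex.Im k)))).
by rewrite pID pIM pRX pIX /=; ring.
Qed.

Lemma pRI_dy P (x y : R) :
  is_derive y 1 (fun y : R => pR P (x, y)) (- pI P^`() (x, y)) /\
  is_derive y 1 (fun y : R => pI P (x, y)) (pR P^`() (x, y)).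
Proof.
elim/poly_ind: P => [|P k [IHR IHI]].
  rewrite deriv0 -[0]/(0%:P); split.
    by under eq_fun do rewrite pRC; rewrite pIC oppr0; exact: is_derive1_cst.
  by under eq_fun do rewrite pIC; rewrite pRC; exact: is_derive1_cst.
rewrite derivMXaddC; split.
  under eq_fun do rewrite pRD pRM pRX pIX pRC.
  apply: (is_derive1_eq (is_derive1D (is_derive1D (is_derive1M IHR (is_derive1_cst y x))
    (is_derive1N (is_derive1M IHI (is_derive1_id y)))) (is_derive1_cst y (complex.Re k)))).
  by rewrite pID pIM pRX pIX /=; ring.
under eq_fun do rewrite pID pIM pRX pIX pIC.
apply: (is_derive1_eq (is_derive1D (is_derive1D (is_derive1M IHR (is_derive1_id y))
    (is_derive1M IHI (is_derive1_cst y x))) (is_derive1_cst y (complex.Im k)))).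
by rewrite pRD pRM pRX pIX /=; ring.
Qed.

Lemma pRI_cx P (y : R) :
  continuous (fun x : R => pR P (x, y)) /\ continuous (fun x : R => pI P (x, y)).
Proof.
by split=> x; have [h1 h2] := pRI_dx P x y;
  [exact: is_derive1_continuous h1|exact: is_derive1_continuous h2].
Qed.
Lemma pRI_cy P (x : R) :
  continuous (fun y : R => pR P (x, y)) /\ continuous (fun y : R => pI P (x, y)).
Proof.
by split=> y; have [h1 h2] := pRI_dy P x y;
  [exact: is_derive1_continuous h1|exact: is_derive1_continuous h2].
Qed.

Section Form.
Variables (a c nu : R).
Hypotheses (c_gt : -1 < c) (nu_ge1 : 1 <= nu) (c_neq0 : c != 0).

(** The real part of P(z) times the conjugate of Q(z). *)
Definition hprod P Q z := pR P z * pR Q z + pI P z * pI Q z.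
Definition form b P Q : R := \int[mu]_z (hprod P Q z * wt a c nu b z).

Lemma subgauss_hprod P Q : subgauss a (hprod P Q).
Proof.
have [h1 h2] := subgauss_pRI a P; have [h3 h4] := subgauss_pRI a Q.
by apply: subgaussD; exact: subgaussM.
Qed.
Lemma measurable_hprod P Q : measurable_fun setT (hprod P Q).
Proof.
have [h1 h2] := measurable_pRI P; have [h3 h4] := measurable_pRI Q.
by apply: measurable_realD; exact: measurable_realM.
Qed.

Lemma integrable_hprod b P Q : mu.-integrable setT (fun z => (hprod P Q z * wt a c nu b z)%:E).
Proof.
apply: (integrable_wt c_gt nu_ge1 (g := fun z => `|hprod P Q z|) (b := b)).
- apply: measurable_realM; [exact: measurable_hprod|exact: measurable_wt].
- exact/subgauss_norm/subgauss_hprod.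
- by move=> z; rewrite normrM [X in _ * X]ger0_norm ?wt_ge0.
Qed.

Lemma form_sym b P Q : form b P Q = form b Q P.
Proof. by apply: eq_Rintegral => z _; rewrite /hprod; congr (_ * _); ring. Qed.

Lemma form_linear b (k : R) P Q S : form b (k%:C *: P + Q) S = k * form b P S + form b Q S.
Proof.
rewrite /form -RintegralZl//; last exact: integrable_hprod.
rewrite -RintegralD//; first last.
- exact: integrable_hprod.
- by apply: (integrableZl measurableT k (integrable_hprod b P S)).
by apply: eq_Rintegral => z _; rewrite /hprod pRD pID pRZ pIZ /=; ring.
Qed.

Local Notation u := ('X - a%:C%:P).

(** The integral of the conjugate Wirtinger derivative of P conj(u S) wt is 0.
That derivative does not see P; on the weight it produces c / conj(z - a),
which cancels against conj(u), and - nu (z - b).  With T1 + i T2 = P conj(u S),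
its real part is half of d/dx (T1 wt) - d/dy (T2 wt), and each of these two
terms integrates to 0. *)
Lemma form_ibp b P S : nu * form b (('X - b%:C%:P) * P) (u * S) =
  form b P (u * S^`() + (1 + c)%:C *: S).
Proof.
set G : {poly R[i]} := u * S; set G' : {poly R[i]} := S + u * S^`().
have dG : deriv G = G' by rewrite /G derivM derivXsubC mul1r.
pose T1 z := pR P z * pR G z + pI P z * pI G z.
pose T2 z := pI P z * pR G z - pR P z * pI G z.
pose T1x z := (pR P^`() z * pR G z + pR P z * pR G' z) + (pI P^`() z * pI G z + pI P z * pI G' z).
pose T2y z := (pR P^`() z * pR G z - pI P z * pI G' z) + (pI P^`() z * pI G z - pR P z * pR G' z).
pose A z := pR P z * pR S z + pI P z * pI S z.
pose B z := pI P z * pR S z - pR P z * pI S z.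
have [mP1 mP2] := measurable_pRI P; have [mG1 mG2] := measurable_pRI G.
have [mP'1 mP'2] := measurable_pRI P^`(); have [mG'1 mG'2] := measurable_pRI G'.
have [sP1 sP2] := subgauss_pRI a P; have [sG1 sG2] := subgauss_pRI a G.
have [sP'1 sP'2] := subgauss_pRI a P^`(); have [sG'1 sG'2] := subgauss_pRI a G'.
have [sS1 sS2] := subgauss_pRI a S.
have sAB : subgauss a (fun z => `|A z| + `|B z|).
  apply: subgaussD; apply: subgauss_norm; apply: subgaussD; try by apply: subgaussM.
  by apply: subgaussN; exact: subgaussM.
have ABle z (h k : R) : dist2 a z != 0 ->
   `|h| <= dist2 a z -> `|k| <= dist2 a z -> `|(A z * h + B z * k) / dist2 a z| <= `|A z| + `|B z|.
  move=> d0 hh kk; have dp : 0 < dist2 a z by rewrite lt_neqAle eq_sym d0 dist2_ge0.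
  rewrite normrM normfV (ger0_norm (dist2_ge0 _ _)) ler_pdivrMr// [leRHS]mulrDl.
  by apply: le_trans (ler_normD _ _) _; apply: lerD; rewrite normrM; exact: ler_wpM2l.
have xx z : `|(z.1 - a) ^+ 2| <= dist2 a z.
  by rewrite ger0_norm ?sqr_ge0// /dist2 lerDl sqr_ge0.
have yy z : `|z.2 ^+ 2| <= dist2 a z.
  by rewrite ger0_norm ?sqr_ge0// /dist2 lerDr sqr_ge0.
have xy z : `|(z.1 - a) * z.2| <= dist2 a z.
  rewrite normrM /dist2 -(real_normK (num_real (z.1 - a))) -(real_normK (num_real z.2)).
  move: `|z.1 - a| `|z.2| (normr_ge0 (z.1 - a)) (normr_ge0 z.2) => x y x0 y0.
  by have := sqr_ge0 (x - y); have := sqr_ge0 (x + y); lra.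
have xy' z : `|z.2 * (z.1 - a)| <= dist2 a z by rewrite mulrC.
(* The convention 0^c = 0 for c <> 0 makes the weight vanish at a, so the pointwise
   identity [key] holds there too, with 1 / 0 read as 0. *)
have dist2_0 z : dist2 a z = 0 -> wt a c nu b z = 0.
  by move=> d0; rewrite /wt d0 powR0// mul0r.
pose H1 z := T1x z + 2 * c * (T1 z * (z.1 - a) / dist2 a z) - 2 * nu * (T1 z * (z.1 - b)).
pose H2 z := T2y z + 2 * c * (T2 z * z.2 / dist2 a z) - 2 * nu * (T2 z * z.2).
have TGR z : pR G z = (z.1 - a) * pR S z - z.2 * pI S z by rewrite /G pRu.
have TGI z : pI G z = (z.1 - a) * pI S z + z.2 * pR S z by rewrite /G pIu.
have [i1 e1] : mu.-integrable setT (fun z => (H1 z * wt a c nu b z)%:E) /\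
    (\int[mu]_z (H1 z * wt a c nu b z)%:E)%E = 0%E.
  apply: (integral_wt_dx c_gt nu_ge1 (T := T1) (Tx := T1x) (G := fun z => `|A z| + `|B z|)) => //.
  - by rewrite /T1x; measurability.
  - by rewrite /T1; measurability.
  - by rewrite /T1; repeat (assumption || apply: subgaussD || apply: subgaussM).
  - by rewrite /T1x; repeat (assumption || apply: subgaussD || apply: subgaussM).
  - move=> z; have [d0|d0] := eqVneq (dist2 a z) 0.
      by rewrite d0 invr0 mulr0 normr0 addr_ge0.
    apply: le_trans (ABle z _ _ d0 (xx z) (xy' z)); rewrite le_eqVlt; apply/orP; left; apply/eqP.
    by congr (`|_ / _|); rewrite /T1 /A /B TGR TGI; ring.
  - move=> x y; have [p1 p2] := pRI_dx P x y; have [g1 g2] := pRI_dx G x y.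
    by rewrite dG in g1 g2; exact: (is_derive1D (is_derive1M p1 g1) (is_derive1M p2 g2)).
  - move=> y x; have [p1 p2] := pRI_cx P y; have [g1 g2] := pRI_cx G y.
    have [p'1 p'2] := pRI_cx P^`() y; have [g'1 g'2] := pRI_cx G' y.
    apply: cvgD; apply: cvgD; exact: (continuousM_line _ _).
have [i2 e2] : mu.-integrable setT (fun z => (H2 z * wt a c nu b z)%:E) /\
    (\int[mu]_z (H2 z * wt a c nu b z)%:E)%E = 0%E.
  apply: (integral_wt_dy b c_gt nu_ge1 (T := T2) (Ty := T2y) (G := fun z => `|A z| + `|B z|)) => //.
  - by rewrite /T2y; measurability.
  - by rewrite /T2; measurability.
  - by rewrite /T2; repeat (assumption || apply: subgaussD || apply: subgaussN || apply: subgaussM).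
  - by rewrite /T2y; repeat (assumption || apply: subgaussD || apply: subgaussN || apply: subgaussM).
  - move=> z; have [d0|d0] := eqVneq (dist2 a z) 0.
      by rewrite d0 invr0 mulr0 normr0 addr_ge0.
    have yy' : `|- z.2 ^+ 2| <= dist2 a z by rewrite normrN.
    apply: le_trans (ABle z _ _ d0 yy' (xy z)); rewrite le_eqVlt; apply/orP; left; apply/eqP.
    by congr (`|_ / _|); rewrite /T2 /A /B TGR TGI; ring.
  - move=> x y; have [p1 p2] := pRI_dy P x y; have [g1 g2] := pRI_dy G x y.
    rewrite dG in g1 g2.
    apply: (is_derive1_eq (is_derive1D (is_derive1M p2 g1) (is_derive1N (is_derive1M p1 g2)))).
    by rewrite /T2y; ring.
  - move=> x y; have [p1 p2] := pRI_cy P x; have [g1 g2] := pRI_cy G x.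
    have [p'1 p'2] := pRI_cy P^`() x; have [g'1 g'2] := pRI_cy G' x.
    apply: cvgD; apply: cvgB; exact: (continuousM_line _ _).
have key z : H1 z * wt a c nu b z - H2 z * wt a c nu b z =
   2 * (hprod P (u * S^`() + (1 + c)%:C *: S) z * wt a c nu b z
       - nu * (hprod (('X - b%:C%:P) * P) G z * wt a c nu b z)).
  have [d0|d0] := eqVneq (dist2 a z) 0; first by rewrite dist2_0 ?d0 //; ring.
  rewrite /H1 /H2 /T1x /T2y /T1 /T2 /hprod !pRu !pIu !pRD !pID !pRZ !pIZ !pRu !pIu /=.
  rewrite /dist2 in d0 *.
  by field.
have ib P1 Q1 := integrable_hprod b P1 Q1.
have : \int[mu]_z (H1 z * wt a c nu b z - H2 z * wt a c nu b z) = 0.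
  by rewrite RintegralB// /Rintegral e1 e2 subrr.
under eq_Rintegral do rewrite key.
pose fA := fun z => hprod P (u * S^`() + (1 + c)%:C *: S) z * wt a c nu b z.
pose fB := fun z => hprod (('X - b%:C%:P) * P) G z * wt a c nu b z.
have iA : mu.-integrable setT (EFin \o fA) := ib _ _.
have iB : mu.-integrable setT (EFin \o fB) := ib _ _.
have iB' : mu.-integrable setT (EFin \o (fun z => nu * fB z)) := integrableZl measurableT nu iB.
have iAB : mu.-integrable setT (EFin \o (fun z => fA z - nu * fB z)) := integrableB measurableT iA iB'.
rewrite -/(\int[mu]_z (2 * (fA z - nu * fB z))) (RintegralZl _ measurableT iAB).
rewrite (RintegralB measurableT iA iB') (RintegralZl _ measurableT iB).
rewrite -/(form b _ _) -/(form b _ _) => e; lra.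
Qed.

Lemma hprod_ge0 P z : 0 <= hprod P P z.
Proof. by rewrite /hprod -!expr2 addr_ge0 ?sqr_ge0. Qed.

Lemma form_ge0 b P : 0 <= form b P P.
Proof. by apply: Rintegral_ge0 => z _; rewrite mulr_ge0 ?hprod_ge0 ?wt_ge0. Qed.

Lemma root_Im_bound P : P != 0 -> exists2 Y, 0 < Y & forall x y : R, Y < y -> ~~ root P (x +i* y).
Proof.
move=> P0; have [r rE] := closed_field_poly_normal P.
exists (1 + \sum_(w <- r) `|complex.Im w|); first by rewrite ltr_pwDl// sumr_ge0.
move=> x y; apply: contraL; rewrite rE rootZ ?lead_coef_eq0// root_prod_XsubC => xr.
rewrite -leNgt (big_rem _ xr)/= addrCA.
by rewrite (le_trans (ler_norm _))// lerDl addr_ge0// sumr_ge0.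
Qed.

(** All roots of P lie below a horizontal line, so the integrand is positive on
a unit square above it. *)
Lemma form_gt0 b P : P != 0 -> 0 < form b P P.
Proof.
move=> P0; rewrite lt_neqAle form_ge0 andbT eq_sym; apply/negP => /eqP f0.
pose f z := hprod P P z * wt a c nu b z.
have fi : mu.-integrable setT (EFin \o f) := integrable_hprod b P P.
have mf : measurable_fun setT (EFin \o f) := measurable_int _ fi.
have i0 : (\int[mu]_z `|(EFin \o f) z| = 0)%E.
  transitivity (\int[mu]_z (f z)%:E)%E.
    by apply: eq_integral => z _; rewrite /= ger0_norm// mulr_ge0 ?hprod_ge0 ?wt_ge0.
  by rewrite -[LHS]fineK ?(integrable_fin_num _ fi)// -/(Rintegral _ _ _) [Rintegral _ _ _]f0.
have [N [mN N0 fN]] := (ae_eq_integral_abs mu measurableT mf).1 i0.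
have [Y Y0 hY] := root_Im_bound P0.
pose E := `[0, 1]%classic `*` `[Y + 1, Y + 2]%classic : set (R * R).
have mE : mu E = 1%E.
  rewrite /E product_measure1E//; rewrite -[RHS]mule1; congr (_ * _)%E.
    by apply: (eq_trans (lebesgue_measure_itv _)); rewrite /= lte_fin ltr01 oppr0 adde0.
  apply: (eq_trans (lebesgue_measure_itv _)); rewrite /= lte_fin ltrD2l ltr1n.
  by rewrite -EFinD; congr (_%:E); ring.
have : (mu E <= mu N)%E.
  apply: le_measure; rewrite ?inE//; first by apply: measurableX; exact: measurable_itv.
  move=> [x y] [/= _]; rewrite in_itv/= => /andP[Yy _]; apply: fN => /= H.
  have {H} /eqP := H I; rewrite eqe mulf_eq0 => /orP[]; apply/negP.
    rewrite gt_eqF// /hprod -!expr2 lt_neqAle addr_ge0 ?sqr_ge0// andbT eq_sym.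
    rewrite paddr_eq0 ?sqr_ge0// !sqrf_eq0 -/(pR P _) /pR /pI.
    have := hY x y (lt_le_trans _ Yy); rewrite ltrDl ltr01 => /(_ isT).
    by rewrite /root /= eq_complex.
  rewrite /wt mulf_neq0// ?gt_eqF ?expR_gt0// powR_gt0// /dist2/=.
  by rewrite ltr_wpDl ?sqr_ge0// exprn_gt0// (lt_le_trans _ Yy)// ltr_wpDr.
by rewrite mE N0 leNgt lte_fin ltr01.
Qed.

(** * Nonnegativity of the number operator *)

Lemma form_euler_sym P S : form a (u * P^`()) S = form a P (u * S^`()).
Proof.
have ss k Q1 Q2 : form a Q1 (u * Q2^`() + k%:C *: Q2) = form a Q1 (u * Q2^`()) + k * form a Q1 Q2.
  by rewrite form_sym addrC form_linear addrC form_sym (form_sym _ Q2).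
have := form_ibp a P S; have := form_ibp a S P.
rewrite (form_sym a (u * S)) => -> ; rewrite !ss (form_sym a S P) (form_sym a S).
by lra.
Qed.

Lemma form0l b P : form b 0 P = 0.
Proof. by have := form_linear b 1 0 0 P; rewrite scaler0 addr0 mul1r; lra. Qed.
Lemma formDl b P Q S : form b (P + Q) S = form b P S + form b Q S.
Proof. by rewrite -[P]scale1r -[1]/(1%:C) form_linear mul1r scale1r. Qed.
Lemma formDr b P Q S : form b S (P + Q) = form b S P + form b S Q.
Proof. by rewrite form_sym formDl !(form_sym b S). Qed.
Lemma formZl b (k : R) P S : form b (k%:C *: P) S = k * form b P S.
Proof. by rewrite -[_ *: _]addr0 form_linear form0l addr0. Qed.
Lemma formZr b (k : R) P S : form b S (k%:C *: P) = k * form b S P.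
Proof. by rewrite form_sym formZl (form_sym b S). Qed.

(** Induction through P = u g + k: constants drop out by symmetry, and
[form_ibp] reduces the pairing of u g with u (g + u g') to sums of terms
that are squares or instances of the induction hypothesis. *)
Lemma form_euler_ge0 m P : (size P <= m)%N -> 0 <= form a P (u * P^`()).
Proof.
elim: m P => [|m IH] P sP.
  move: sP; rewrite leqn0 size_poly_eq0 => /eqP ->; rewrite form0l//.
have [g gE] := poly_XsubC_decomp a%:C P.
have sg : (size g <= m)%N.
  apply: (@size_XsubC_mul_le _ a%:C); rewrite (_ : _ * g = P - (P.[a%:C])%:P).
    rewrite (leq_trans (size_polyD _ _))// geq_max sP size_polyN.
    by rewrite (leq_trans (size_polyC_leq1 _)).
  by rewrite {1}gE addrK.
rewrite {1}gE formDl; set k := P.[a%:C].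
have -> : form a k%:P (u * P^`()) = 0 by rewrite -form_euler_sym derivC mulr0 form0l.
have -> : deriv P = g + u * g^`() by rewrite gE derivD derivC addr0 derivM derivXsubC mul1r.
rewrite addr0; set h := g + u * g^`().
have nu0 : 0 < nu := lt_le_trans ltr01 nu_ge1.
have c1 : 0 <= 1 + c by rewrite -lerBlDl sub0r ltW.
rewrite -(pmulr_rge0 _ nu0) form_ibp formDr formZr -form_euler_sym.
have -> : form a (u * g^`()) h = form a g (u * g^`()) + form a (u * g^`()) (u * g^`()).
  by rewrite /h formDr (form_sym a _ g).
have -> : form a g h = form a g g + form a g (u * g^`()) by rewrite /h formDr.
have := IH _ sg; have := form_ge0 a g; have := form_ge0 a (u * g^`()) => h1 h2 h3.
have : 0 <= (1 + c) * (form a g g + form a g (u * g^`())).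
  by apply: mulr_ge0 => //; exact: addr_ge0.
lra.
Qed.

Lemma form_number_centered P : (1 + c) * form a P P <= nu * form a (u * P) (u * P).
Proof.
rewrite form_ibp formDr formZr.
have := form_euler_ge0 (leqnn (size P)); lra.
Qed.

Let kappa := a * nu.
Hypothesis a_ge0 : 0 <= a.

(** Polynomials converging to exp(- kappa (z - a)), dominated by
exp(kappa |z - a|). *)
Definition exp_approx m : {poly R[i]} := (1 - (kappa / m.+1%:R)%:C *: u) ^+ m.+1.

Lemma hprod_mul P Q z : hprod (P * Q) (P * Q) z = hprod P P z * hprod Q Q z.
Proof. by rewrite /hprod !pRM !pIM; ring. Qed.

Lemma hprod_exp P z m : hprod (P ^+ m) (P ^+ m) z = hprod P P z ^+ m.
Proof.
elim: m => [|m IH]; last by rewrite !exprS hprod_mul IH.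
by rewrite !expr0 /hprod !pR1 !pI1; ring.
Qed.

Lemma hprod_exp_approx m z : hprod (exp_approx m) (exp_approx m) z =
  (1 + (- (2 * kappa * (z.1 - a)) + kappa ^+ 2 * dist2 a z / m.+1%:R) / m.+1%:R) ^+ m.+1.
Proof.
rewrite hprod_exp; congr (_ ^+ _).
rewrite -[u]mulr1 -scaleNr /hprod !pRD !pID !pRZ !pIZ !pRu !pIu !pR1 !pI1 /= oppr0.
by rewrite /dist2; field; rewrite nat1r.
Qed.

Lemma exp_approx_cvg (z : R * R) :
  hprod (exp_approx m) (exp_approx m) z @[m --> \oo] --> expR (- (2 * kappa * (z.1 - a))).
Proof.
under eq_fun do rewrite hprod_exp_approx; apply: cvg_exp_sequence.
rewrite -[X in _ --> X]addr0; apply: cvgD; first exact: cvg_cst.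
rewrite -(mulr0 (kappa ^+ 2 * dist2 a z)); apply: cvgMr; exact: cvg_harmonic.
Qed.

Let kappa_ge0 : 0 <= kappa.
Proof. by rewrite mulr_ge0// (le_trans ler01). Qed.

(** The distance to a, written as a power so that it is measurable by composition. *)
Definition rad z : R := dist2 a z `^ 2^-1.

Lemma rad_sqr z : rad z ^+ 2 = dist2 a z.
Proof. by rewrite /rad powR12_sqrt ?dist2_ge0// sqr_sqrtr// dist2_ge0. Qed.

Lemma exp_approx_le m z : hprod (exp_approx m) (exp_approx m) z <= expR (2 * kappa * rad z).
Proof.
have r0 : 0 <= rad z := powR_ge0 _ _.
have Xr : - (z.1 - a) <= rad z.
  rewrite (le_trans (ler_norm _))// normrN -ler_sqr ?nnegrE// rad_sqr real_normK ?num_real//.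
  by rewrite /dist2 lerDl sqr_ge0.
rewrite hprod_exp_approx (_ : 2 * kappa * rad z = m.+1%:R * (2 * kappa * rad z / m.+1%:R)); last first.
  by rewrite [RHS]mulrC divfK.
rewrite expRM_natl lerXn2r ?nnegrE ?expR_ge0//.
  have -> : 1 + (- (2 * kappa * (z.1 - a)) + kappa ^+ 2 * dist2 a z / m.+1%:R) / m.+1%:R
    = (1 - kappa / m.+1%:R * (z.1 - a)) ^+ 2 + (kappa / m.+1%:R * z.2) ^+ 2.
    by rewrite /dist2; field; rewrite nat1r.
  by rewrite addr_ge0 ?sqr_ge0.
set k := kappa / m.+1%:R.
have k0 : 0 <= k by rewrite divr_ge0.
apply: (@le_trans _ _ ((1 + k * rad z) ^+ 2)).
  have -> : 1 + (- (2 * kappa * (z.1 - a)) + kappa ^+ 2 * dist2 a z / m.+1%:R) / m.+1%:R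
    = 1 + 2 * (k * - (z.1 - a)) + k ^+ 2 * dist2 a z.
    by rewrite /k; field; rewrite nat1r.
  rewrite -rad_sqr (_ : (1 + k * rad z) ^+ 2 = 1 + 2 * (k * rad z) + k ^+ 2 * rad z ^+ 2); last by ring.
  by rewrite lerD2r lerD2l ler_wpM2l// ler_wpM2l.
rewrite (_ : 2 * kappa * rad z / m.+1%:R = k * rad z + k * rad z); last by rewrite /k; ring.
have h0 : 0 <= 1 + k * rad z by rewrite addr_ge0// mulr_ge0.
by rewrite expRD expr2; apply: ler_pM => //; exact: expR_ge1Dx.
Qed.

Lemma subgauss_exp_rad (k : R) : 0 <= k -> subgauss a (fun z => expR (k * rad z)).
Proof.
move=> k0 e e0; exists (expR (k ^+ 2 / e)) => [|z]; first exact: expR_ge0.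
rewrite ger0_norm ?expR_ge0// -expRD ler_expR -rad_sqr.
have : 0 <= (k / 2 - e * rad z) ^+ 2 / e by rewrite divr_ge0 ?sqr_ge0 ?ltW.
have -> : (k / 2 - e * rad z) ^+ 2 / e = k ^+ 2 / e / 4 - k * rad z + e * rad z ^+ 2.
  by field; exact: lt0r_neq0.
have : 0 <= k ^+ 2 / e by rewrite divr_ge0 ?sqr_ge0 ?ltW.
lra.
Qed.

(** Up to a constant, |exp(- a nu (z - a))|^2 times the weight centred at a is
the weight centred at 0.  Apply the centred inequality to P times [exp_approx]
and let m tend to infinity by dominated convergence. *)
Lemma form_number P : (1 + c) * form 0 P P <= nu * form 0 (u * P) (u * P).
Proof.
pose q z := (nu * dist2 a z - (1 + c)) * hprod P P z.
pose Fm m z := q z * hprod (exp_approx m) (exp_approx m) z * wt a c nu a z.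
pose F z := q z * expR (- (2 * kappa * (z.1 - a))) * wt a c nu a z.
pose g z := `|q z| * expR (2 * kappa * rad z) * wt a c nu a z.
have mhp Q := measurable_hprod Q Q.
have mw b : measurable_fun setT (wt a c nu b) by exact: measurable_wt.
have md : measurable_fun setT (dist2 a) by rewrite /dist2; measurability.
have mq : measurable_fun setT q.
  by rewrite /q; apply: measurable_realM => //; measurability.
have sq : subgauss a q.
  apply: subgaussM; last exact: subgauss_hprod.
  apply: subgaussD; last exact: subgauss_cst.
  by apply: subgaussM; [exact: subgauss_cst|exact: subgauss_dist2].
have mg : measurable_fun setT g.
  by rewrite /g /rad; apply: measurable_realM => //; measurability.
have ig : mu.-integrable setT (EFin \o g).
  apply: (integrable_wt c_gt nu_ge1 (g := fun z => `|q z| * expR (2 * kappa * rad z)) (b := a)) => //.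
    by apply: subgaussM; [exact: (subgauss_norm sq)|apply: subgauss_exp_rad; rewrite mulr_ge0].
  move=> z; rewrite ger0_norm//; apply: mulr_ge0 (wt_ge0 _ _ _ _ _).
  by apply: mulr_ge0; [exact: normr_ge0|exact: expR_ge0].
have mFm m : measurable_fun setT (Fm m) by apply: measurable_realM => //; exact: measurable_realM.
have mF : measurable_fun setT F.
  by rewrite /F; apply: measurable_realM => //; apply: measurable_realM => //; measurability.
have hdE Q z : hprod (u * Q) (u * Q) z = dist2 a z * hprod Q Q z.
  by rewrite /hprod !pRu !pIu /dist2; ring.
have key b Q : nu * form b (u * Q) (u * Q) - (1 + c) * form b Q Q =
    \int[mu]_z ((nu * dist2 a z - (1 + c)) * hprod Q Q z * wt a c nu b z).
  rewrite /form -!RintegralZl//; [|exact: integrable_hprod|exact: integrable_hprod].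
  rewrite -RintegralB//; first last.
  - exact: (integrableZl measurableT (1 + c) (integrable_hprod b Q Q)).
  - exact: (integrableZl measurableT nu (integrable_hprod b (u * Q) (u * Q))).
  by apply: eq_Rintegral => z _; rewrite hdE; ring.
have Fm_ge0 m : 0 <= \int[mu]_z Fm m z.
  have := form_number_centered (P * exp_approx m); rewrite -subr_ge0 key.
  congr (0 <= _); apply: eq_Rintegral => z _; rewrite hprod_mul /Fm /q; ring.
have FmF z : Fm m z @[m --> \oo] --> F z.
  apply: cvgM; last exact: cvg_cst.
  by apply: cvgM; [exact: cvg_cst|exact: exp_approx_cvg].
have Fmg m z : `|Fm m z| <= g z.
  rewrite /Fm /g normrM [`|wt _ _ _ _ _|]ger0_norm ?wt_ge0//.
  apply: ler_wpM2r; first exact: wt_ge0.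
  rewrite normrM [`|hprod _ _ _|]ger0_norm ?hprod_ge0//.
  by apply: ler_wpM2l => //; exact: exp_approx_le.
have [iF _ cv] : [/\ mu.-integrable setT (EFin \o F),
    (\int[mu]_z `|(EFin \o Fm m) z - (EFin \o F) z| @[m --> \oo] --> 0)%E &
    (\int[mu]_z (EFin \o Fm m) z @[m --> \oo] --> \int[mu]_z (EFin \o F) z)%E].
  apply: (@dominated_convergence _ _ _ mu _ _ (fun m => EFin \o Fm m) (EFin \o F) (EFin \o g)) => //.
  - by move=> m; apply/measurable_EFinP; exact: mFm.
  - exact/measurable_EFinP.
  - apply: aeW => z _; apply: cvg_EFin; first exact: nearW.
    exact: FmF.
  - by apply: aeW => z m _; rewrite /= lee_fin.
have iFm m : mu.-integrable setT (EFin \o Fm m).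
  apply: le_integrable ig => //; first by apply/measurable_EFinP; exact: mFm.
  by move=> z _; rewrite /= lee_fin (le_trans (Fmg m z))// ler_norm.
have F_ge0 : 0 <= \int[mu]_z F z.
  rewrite /Rintegral fine_ge0// -(cvg_lim _ cv)//; apply: lime_ge.
    by apply/cvg_ex; eexists; exact: cv.
  apply: nearW => m; rewrite -[leRHS]fineK ?(integrable_fin_num _ (iFm m))// lee_fin.
  exact: Fm_ge0.
rewrite -subr_ge0 key.
have -> : \int[mu]_z ((nu * dist2 a z - (1 + c)) * hprod P P z * wt a c nu 0 z) =
   \int[mu]_z (expR (- (nu * a ^+ 2)) * F z).
  apply: eq_Rintegral => z _; rewrite /F /q /wt.
  have -> : - (nu * ((z.1 - 0) ^+ 2 + z.2 ^+ 2)) =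
    - (nu * a ^+ 2) + (- (2 * kappa * (z.1 - a)) - nu * ((z.1 - a) ^+ 2 + z.2 ^+ 2)).
    by rewrite /kappa; ring.
  by rewrite !expRD; ring.
by rewrite RintegralZl// mulr_ge0// expR_ge0.
Qed.

End Form.
End PolyPlane.

(** * The orthogonal polynomials have real coefficients *)

Section RealForm.
Variable R : realType.
Local Notation leb := (@lebesgue_measure R).
Local Notation mu := (leb \x leb)%E.
Variables (N : nat) (a c : R) (P : nat -> {poly R[i]}) (h : nat -> R).
Hypotheses (N_gt0 : (1 <= N)%N) (a_gt0 : 0 < a) (c_gt : -1 < c) (c_neq0 : c != 0).
Hypothesis hP : monic_orthogonal N a c P h.
Local Notation nu := (N%:R : R).
Local Notation form := (form a c nu 0).
Local Notation rC := (map_poly (real_complex R)).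

Let nu_ge1 : 1 <= nu. Proof. by rewrite ler1n. Qed.

Lemma weightE (z : R * R) : weight N a c (z.1 +i* z.2) = wt a c nu 0 z.
Proof.
rewrite /weight /wt /dist2 !normc_def /= subr0 oppr0 addr0.
rewrite sqr_sqrtr ?addr_ge0 ?sqr_ge0//; congr (_ * _).
by rewrite powRrM -powR12_sqrt ?addr_ge0 ?sqr_ge0// -!powRrM mulrA mulVf// mul1r.
Qed.

(** The imaginary part of the pairing of p and q is the real part of the
pairing of p and i q. *)
Lemma integral_dA_form (p q : {poly R[i]}) :
  integral_dA (fun z => p.[z] * conjc q.[z] * (weight N a c z)%:C) =
  (pi^-1)%:C * (form p q +i* form p ((0 +i* 1) *: q)).
Proof.
rewrite /integral_dA; congr (_ * (_ +i* _)); apply: eq_Rintegral => z _.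
  rewrite weightE /hprod /pR /pI !cReM cImM /=.
  by case: (p.[_]) (q.[_]) => [x y] [x' y'] /=; ring.
rewrite weightE /hprod !pRZ !pIZ /pR /pI !cImM !cReM /=.
by case: (p.[_]) (q.[_]) => [x y] [x' y'] /=; ring.
Qed.

Lemma form_P j k : form (P j) (P k) = pi * (if j == k then h j else 0) /\
  form (P j) ((0 +i* 1) *: P k) = 0.
Proof.
have := hP.2 j k; rewrite integral_dA_form => /eqP; rewrite eq_complex /= !mul0r subr0 addr0.
move=> /andP[/eqP e1 /eqP e2].
have p0 : pi != 0 :> R by rewrite gt_eqF// pi_gt0.
split.
  by apply: (mulfI (invr_neq0 p0)); rewrite e1 mulKf//; case: eqP.
by apply: (mulfI (invr_neq0 p0)); rewrite e2 mulr0; case: eqP.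
Qed.

Definition realform (p q : {poly R}) := pi^-1 * form (rC p) (rC q).
Definition imform (p q : {poly R}) := form (rC p) ((0 +i* 1) *: rC q).

Lemma rCZD (k : R) p q : rC (k *: p + q) = k%:C *: rC p + rC q.
Proof. by rewrite rmorphD /= map_polyZ. Qed.

Lemma form_rotate p q : form p ((0 +i* 1) *: q) = - form q ((0 +i* 1) *: p).
Proof.
rewrite -[RHS]mulN1r -formZr//; apply: eq_Rintegral => z _.
by rewrite /hprod !pRZ !pIZ /=; ring.
Qed.

Lemma realform_linear k p q r : realform (k *: p + q) r = k * realform p r + realform q r.
Proof. by rewrite /realform rCZD form_linear//; ring. Qed.
Lemma realform_sym p q : realform p q = realform q p.
Proof. by rewrite /realform form_sym. Qed.
Lemma rC_eq0 p : (rC p == 0) = (p == 0). Proof. exact: map_poly_eq0. Qed.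
Lemma realform_gt0 p : p != 0 -> 0 < realform p p.
Proof. by move=> p0; rewrite mulr_gt0 ?invr_gt0 ?pi_gt0// form_gt0// rC_eq0. Qed.
Lemma rC_u (p : {poly R}) (b : R) : rC (('X - b%:P) * p) = ('X - b%:C%:P) * rC p.
Proof. by rewrite rmorphM rmorphB /= map_polyX map_polyC. Qed.
Lemma rC_X (p : {poly R}) : rC ('X * p) = ('X - 0%:C%:P) * rC p.
Proof. by rewrite -rC_u subr0. Qed.
Lemma rC_euler (g : {poly R}) : rC (('X - a%:P) * g^`() + (1 + c) *: g) =
  ('X - a%:C%:P) * (rC g)^`() + (1 + c)%:C *: rC g.
Proof. by rewrite addrC rCZD rC_u -deriv_map addrC. Qed.
Lemma realform_ibp p g : nu * realform ('X * p) (('X - a%:P) * g) =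
  realform p (('X - a%:P) * g^`() + (1 + c) *: g).
Proof. by rewrite /realform rC_X rC_u rC_euler mulrCA form_ibp. Qed.
Lemma realform_number p : (1 + c) * realform p p <=
  nu * realform (('X - a%:P) * p) (('X - a%:P) * p).
Proof.
rewrite /realform rC_u !(mulrCA _ pi^-1) ler_wpM2l ?invr_ge0 ?pi_ge0//.
by apply: form_number => //; exact: ltW.
Qed.

Lemma imform_eq0 p q : imform p q = 0.
Proof.
apply: (antisym_form_eq0 (a := a) (c := c) (nu := nu)).
- by rewrite gt_eqF.
- by rewrite gt_eqF// (lt_le_trans ltr01).
- by move=> k f g r; rewrite /imform rCZD form_linear.
- by move=> f g; rewrite /imform form_rotate.
- move=> f g; rewrite /imform rC_X rC_u rC_euler.
  have -> : (0 +i* 1) *: (('X - a%:C%:P) * rC g) = ('X - a%:C%:P) * ((0 +i* 1) *: rC g).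
    by rewrite scalerAr.
  rewrite form_ibp// derivZ; congr (form _ _).
  by rewrite -scalerAr scalerDr; congr (_ + _); rewrite !scalerA mulrC.
Qed.

Definition rePoly (p : {poly R[i]}) : {poly R} := \poly_(i < size p) complex.Re p`_i.
Definition imPoly (p : {poly R[i]}) : {poly R} := \poly_(i < size p) complex.Im p`_i.

Lemma reimPoly p : p = rC (rePoly p) + (0 +i* 1) *: rC (imPoly p).
Proof.
apply/polyP => i; rewrite coefD coefZ !coef_map /=.
by case: (p`_i) => x y; apply/eqP; rewrite eq_complex /=; apply/andP; split; apply/eqP; ring.
Qed.

Lemma P_size j : size (P j) = j.+1. Proof. exact: (hP.1 j).2. Qed.
Lemma P_lead j : (P j)`_j = 1.
Proof. by have := (hP.1 j).1; rewrite monicE lead_coefE P_size => /eqP. Qed.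

Lemma form_P_lt m j (q : {poly R[i]}) : (m <= j)%N -> (size q <= m)%N -> form (P j) q = 0.
Proof.
elim: m q => [|m IH] q mj sq.
  move: sq; rewrite leqn0 size_poly_eq0 => /eqP ->.
  by rewrite form_sym form0l.
rewrite -(subrK (q`_m *: P m) q) formDr// IH ?add0r; first last.
- exact: size_sub_lead (hP.1 m).1 (P_size m) sq.
- exact: ltnW.
have -> : q`_m *: P m = (complex.Re q`_m)%:C *: P m + (complex.Im q`_m)%:C *: ((0 +i* 1) *: P m).
  rewrite scalerA -scalerDl; congr (_ *: _); case: (q`_m) => x y.
  by apply/eqP; rewrite eq_complex /=; apply/andP; split; apply/eqP; ring.
have [e1 e2] := form_P j m; rewrite formDr// !formZr// e1 e2.
by rewrite gtn_eqF// mulr0 mulr0 mulr0 addr0.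
Qed.

(** Write P_j = U + i V with V of degree less than j.  Pairing P_j with i V
gives 0 = <V, V>, since the pairing of U with i V is an imaginary part and
vanishes. *)
Lemma imPoly_P j : imPoly (P j) = 0.
Proof.
apply/eqP/negP => /negP V0.
have sV : (size (imPoly (P j)) <= j)%N.
  apply/leq_sizeP => k; rewrite leq_eqVlt => /orP[/eqP <-|jk]; rewrite /imPoly coef_poly P_size.
    by rewrite ltnS leqnn P_lead.
  by rewrite ltnS leqNgt jk.
have := realform_gt0 V0; set V := imPoly _; set U := rePoly (P j).
have : form (P j) ((0 +i* 1) *: rC V) = 0.
  apply: (form_P_lt (leqnn j)); rewrite (leq_trans (size_scale_leq _ _))//.
  by rewrite size_map_inj_poly//; exact: complexI.
rewrite {1}(reimPoly (P j)) formDl// -/(imform U V) imform_eq0 add0r.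
have -> : form ((0 +i* 1) *: rC V) ((0 +i* 1) *: rC V) = form (rC V) (rC V).
  by apply: eq_Rintegral => z _; rewrite /hprod !pRZ !pIZ /=; ring.
by rewrite /realform => ->; rewrite mulr0 ltxx.
Qed.

Lemma P_real j : P j = rC (rePoly (P j)).
Proof. by rewrite {1}(reimPoly (P j)) imPoly_P rmorph0 scaler0 addr0. Qed.

Lemma rePoly_monic j : rePoly (P j) \is monic /\ size (rePoly (P j)) = j.+1.
Proof.
have sz : size (rePoly (P j)) = j.+1.
  by have := P_size j; rewrite {1}(P_real j) size_map_inj_poly//; exact: complexI.
split => //; rewrite monicE lead_coefE sz /= /rePoly coef_poly P_size ltnSn P_lead.
by [].
Qed.

Lemma realform_orth j k : realform (rePoly (P j)) (rePoly (P k)) = if j == k then h j else 0.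
Proof.
rewrite /realform -!P_real; have [-> _] := form_P j k.
by rewrite mulKf// gt_eqF// pi_gt0.
Qed.

End RealForm.

(** * Wirtinger calculus along the coordinate axes *)

Section ComplexDerivatives.
Variable R : realType.
Implicit Types (f g : R -> R[i]) (t : R) (v w : R[i]) (F G : R[i] -> R[i]).

(** Derivatives of real and imaginary parts along a real parameter, as in the
definition of the partial derivatives. *)
Definition cderiv f t v :=
  is_derive t 1 (fun s : R => complex.Re (f s)) (complex.Re v) /\
  is_derive t 1 (fun s : R => complex.Im (f s)) (complex.Im v).

Lemma cderiv_cst t k : cderiv (fun=> k) t 0.
Proof. by split; exact: is_derive1_cst. Qed.

Lemma cderiv_eq f t v w : cderiv f t v -> v = w -> cderiv f t w.
Proof. by move=> h <-. Qed.

Lemma cderivD f g t v w : cderiv f t v -> cderiv g t w ->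
  cderiv (fun s => f s + g s) t (v + w).
Proof.
move=> [f1 f2] [g1 g2]; split.
  under eq_fun do rewrite cReD; rewrite cReD; exact: is_derive1D.
under eq_fun do rewrite cImD; rewrite cImD; exact: is_derive1D.
Qed.

Lemma cderivM f g t v w : cderiv f t v -> cderiv g t w ->
  cderiv (fun s => f s * g s) t (v * g t + f t * w).
Proof.
move=> [f1 f2] [g1 g2]; split.
  under eq_fun do rewrite cReM.
  apply: (is_derive1_eq (is_derive1D (is_derive1M f1 g1) (is_derive1N (is_derive1M f2 g2)))).
  by rewrite cReD !cReM; ring.
under eq_fun do rewrite cImM.
apply: (is_derive1_eq (is_derive1D (is_derive1M f1 g2) (is_derive1M f2 g1))).
by rewrite cImD !cImM; ring.
Qed.

Lemma cderiv_conj f t v : cderiv f t v -> cderiv (fun s => conjc (f s)) t (conjc v).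
Proof.
have E x : complex.Re (conjc x) = complex.Re x :> R by case: x.
have E' x : complex.Im (conjc x) = - complex.Im x :> R by case: x.
move=> [f1 f2]; split.
  by under eq_fun do rewrite E; rewrite E.
by under eq_fun do rewrite E'; rewrite E'; exact: is_derive1N.
Qed.

Lemma cderiv_exp f t v : cderiv f t v -> cderiv (fun s => cexp (f s)) t (cexp (f t) * v).
Proof.
have E x : complex.Re (cexp x) = expR (complex.Re x) * cos (complex.Im x) :> R.
  by case: x => x y; rewrite /cexp /=; ring.
have E' x : complex.Im (cexp x) = expR (complex.Re x) * sin (complex.Im x) :> R.
  by case: x => x y; rewrite /cexp /=; ring.
move=> [f1 f2]; split.
  under eq_fun do rewrite E.
  apply: (is_derive1_eq (is_derive1M (is_derive1_expR f1) (is_derive1_comp (is_derive_cos _) f2))).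
  by rewrite cReM E E' /= mulNr mulrN mulrA mulrAC.
under eq_fun do rewrite E'.
apply: (is_derive1_eq (is_derive1M (is_derive1_expR f1) (is_derive1_comp (is_derive_sin _) f2))).
by rewrite cImM E E' /= addrC mulrA [X in _ + X]mulrAC.
Qed.

Lemma cderiv_sum n (f : 'I_n -> R -> R[i]) t (v : 'I_n -> R[i]) :
  (forall j, cderiv (f j) t (v j)) ->
  cderiv (fun s => \sum_(j < n) f j s) t (\sum_(j < n) v j).
Proof.
elim: n f v => [|n IH] f v h.
  under eq_fun do rewrite big_ord0; rewrite big_ord0; exact: cderiv_cst.
under eq_fun do rewrite big_ord_recr; rewrite big_ord_recr /=.
by apply: cderivD => //; apply: IH.
Qed.

(** Complex differentiability only through the two partials and the
Cauchy-Riemann equation; enough for [dbar]. *)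
Definition hderiv F z d :=
  cderiv (fun x => F (x +i* complex.Im z)) (complex.Re z) d /\
  cderiv (fun y => F (complex.Re z +i* y)) (complex.Im z) ('i%C * d).

(** The antiholomorphic counterpart; d is then the value of [dbar]. *)
Definition aderiv F z d :=
  cderiv (fun x => F (x +i* complex.Im z)) (complex.Re z) d /\
  cderiv (fun y => F (complex.Re z +i* y)) (complex.Im z) (- 'i%C * d).

Lemma dbar_aderiv F z d : aderiv F z d -> dbar F z = d.
Proof.
move=> [[x1 x2] [y1 y2]]; rewrite /dbar /partial_x /partial_y !derive1E.
rewrite (@derive_val _ _ _ _ _ _ _ x1) (@derive_val _ _ _ _ _ _ _ x2).
rewrite (@derive_val _ _ _ _ _ _ _ y1) (@derive_val _ _ _ _ _ _ _ y2).
have eta (w : R[i]) : complex.Re w +i* complex.Im w = w by case: w.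
rewrite !eta mulNr mulrN mulrA -expr2 sqr_i mulN1r opprK.
by rewrite (_ : d + d = 2 * d) ?mulKf ?pnatr_eq0//; ring.
Qed.

Lemma reimE (w : R[i]) : complex.Re w +i* complex.Im w = w. Proof. by case: w. Qed.

Lemma hderiv_conj F z d : hderiv F z d -> aderiv (fun w => conjc (F w)) z (conjc d).
Proof.
move=> [h1 h2]; split; first exact: cderiv_conj.
apply: (cderiv_eq (cderiv_conj h2)); case: d {h1 h2} => x y.
by apply/eqP; rewrite eq_complex /=; apply/andP; split; apply/eqP; ring.
Qed.

Lemma hderivM F G z d e : hderiv F z d -> hderiv G z e ->
  hderiv (fun w => F w * G w) z (d * G z + F z * e).
Proof.
move=> [f1 f2] [g1 g2]; split.
  by apply: (cderiv_eq (cderivM f1 g1)); rewrite reimE.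
by apply: (cderiv_eq (cderivM f2 g2)); rewrite reimE; ring.
Qed.

Lemma aderivM F G z d e : aderiv F z d -> aderiv G z e ->
  aderiv (fun w => F w * G w) z (d * G z + F z * e).
Proof.
move=> [f1 f2] [g1 g2]; split.
  by apply: (cderiv_eq (cderivM f1 g1)); rewrite reimE.
by apply: (cderiv_eq (cderivM f2 g2)); rewrite reimE; ring.
Qed.

Lemma hderiv_cst k z : hderiv (fun=> k) z 0.
Proof. by split; [|rewrite mulr0]; exact: cderiv_cst. Qed.

Lemma aderiv_cst k z : aderiv (fun=> k) z 0.
Proof. by split; [|rewrite mulr0]; exact: cderiv_cst. Qed.

Lemma aderiv_exp F z d : aderiv F z d -> aderiv (fun w => cexp (F w)) z (cexp (F z) * d).
Proof.
move=> [f1 f2]; split.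
  by apply: (cderiv_eq (cderiv_exp f1)); rewrite reimE.
by apply: (cderiv_eq (cderiv_exp f2)); rewrite reimE; ring.
Qed.

Lemma aderiv_sum n (F : 'I_n -> R[i] -> R[i]) z (d : 'I_n -> R[i]) :
  (forall j, aderiv (F j) z (d j)) ->
  aderiv (fun w => \sum_(j < n) F j w) z (\sum_(j < n) d j).
Proof.
move=> h; split; first by apply: cderiv_sum => j; have [] := h j.
by rewrite mulr_sumr; apply: cderiv_sum => j; have [] := h j.
Qed.

Lemma hderiv_poly (P : {poly R[i]}) z : hderiv (fun w => P.[w]) z P^`().[z].
Proof.
case: z => x y; have [x1 x2] := pRI_dx P x y; have [y1 y2] := pRI_dy P x y.
split; split => //.
  by apply: (is_derive1_eq y1); rewrite cReM /pI /= mul0r mul1r sub0r.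
by apply: (is_derive1_eq y2); rewrite cImM /pR /= mul0r mul1r add0r.
Qed.

Lemma aderiv_conj_id z : aderiv (fun w => conjc w) z 1.
Proof.
have := hderiv_conj (hderiv_poly 'X z); rewrite derivX hornerC conjc1.
by under eq_fun do rewrite hornerX.
Qed.

Lemma complex_derivable_cvg (b : R[i] -> R[i]) z :
  derivable (b : R[i]^o -> R[i]^o) z 1 -> exists d, forall e : R, 0 < e ->
    exists2 r : R, 0 < r & forall k : R[i], k != 0 -> `|k| < r%:C ->
      `|k^-1 * (b (k + z) - b z) - d| < e%:C.
Proof.
move=> /cvg_ex[d hd]; exists d => e e0.
have e0' : 0 < e%:C by rewrite ltcR.
have /cvgrPdist_lt/(_ _ e0') := hd.
case=> /= -[r1 r2] r0 hr; move: r0; rewrite ltcE /= => /andP[/eqP r20 r10].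
exists r1 => // k k0 kr; rewrite distrC.
have := hr k; rewrite /ball_ /= sub0r normrN -[_%:A]/(_ * _) mulr1; apply => //.
by rewrite (_ : r1 +i* r2 = r1%:C)// r20.
Qed.

(** Restrict the complex difference quotient to real and to imaginary
increments. *)
Lemma hderiv_derivable (b : R[i] -> R[i]) z :
  derivable (b : R[i]^o -> R[i]^o) z 1 -> exists d, hderiv b z d.
Proof.
move=> /complex_derivable_cvg[d hd]; exists d.
(* The derivative along the line through z in the direction w. *)
have dir (w : R[i]) (t0 : R) : `|w| = 1 -> cderiv (fun t => b (z + (t - t0)%:C * w)) t0 (w * d).
  move=> w1.
  have w0 : w != 0 by rewrite -normr_eq0 w1 oner_neq0.
  have key (p : R[i] -> R) (pB : forall x y, p (x - y) = p x - p y)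
     (pZ : forall (k : R) x, p (k%:C * x) = k * p x)
     (pn : forall x, (`|p x|)%:C <= `|x|) :
     is_derive t0 1 (fun t => p (b (z + (t - t0)%:C * w))) (p (w * d)).
    have cv : (h^-1 *: (((fun t => p (b (z + (t - t0)%:C * w))) \o shift t0) (h *: 1) -
        p (b (z + (t0 - t0)%:C * w))) @[h --> 0^'] --> p (w * d))%classic.
      apply/cvgrPdist_lt => e e0; have [r r0 hr] := hd e e0.
      exists r => //= h; rewrite /ball_ /= sub0r normrN => hr0 h0.
      have hC0 : h%:C != 0 :> R[i] by rewrite eq_complex /= (negPf h0).
      have := hr (h%:C * w); rewrite mulf_neq0// => /(_ isT).
      rewrite normrM w1 mulr1 normc_def /= expr0n /= addr0 sqrtr_sqr ltcR => /(_ hr0).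
      set q := _^-1 * _ => hq; rewrite -ltcR; apply: le_lt_trans hq.
      rewrite -[h *: 1]/(h * 1) mulr1 addrK subrr mul0r addr0 -[_ *: _]/(_ * _).
      rewrite distrC -pB -pZ -pB; apply: le_trans (pn _) _.
      have -> : h^-1%:C * (b (z + h%:C * w) - b z) - w * d = w * (q - d).
        rewrite /q [h%:C * w + z]addrC invfM fmorphV; field.
        by rewrite w0 hC0.
      by rewrite normrM w1 mul1r.
    by apply: DeriveDef; [exact: (cvgP _ cv) | exact: (cvg_lim _ cv)].
  split.
    apply: (key (@complex.Re R)) => [x y|k x|x].
    - by case: x y => [? ?] [? ?].
    - by case: x => x y /=; rewrite mul0r subr0.
    - exact: normc_ge_Re.
  apply: (key (@complex.Im R)) => [x y|k x|x].
  - by case: x y => [? ?] [? ?].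
  - by case: x => x y /=; rewrite mul0r addr0.
  - rewrite normc_def lecR; case: x => x y /=; rewrite -sqrtr_sqr.
    by rewrite ler_sqrt ?addr_ge0 ?sqr_ge0// lerDr sqr_ge0.
have n1 : `|1 : R[i]| = 1 by rewrite normr1.
have ni : `|'i%C : R[i]| = 1 by rewrite normc_def /= expr0n expr1n add0r sqrtr1.
split.
  have := dir 1 (complex.Re z) n1; rewrite mul1r; congr (cderiv _ _ _).
  apply/funext => t; congr b; case: z {hd dir} => x y.
  by apply/eqP; rewrite eq_complex /=; apply/andP; split; apply/eqP; ring.
have := dir 'i%C (complex.Im z) ni; congr (cderiv _ _ _).
apply/funext => t; congr b; case: z {hd dir} => x y.
by apply/eqP; rewrite eq_complex /=; apply/andP; split; apply/eqP; ring.
Qed.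

(** * Derivative of a branch of the power function *)

Section Branch.
Variables (D : set R[i]^o) (a c : R) (b : R[i] -> R[i]).
Hypothesis hb : power_branch D a c b.

(** The modulus of exp(c l) does not depend on the choice of the logarithm l;
this is all that is used of the pointwise definition of the branch. *)
Lemma branch_norm z : D z -> 0 < dist2 a (complex.Re z, complex.Im z) /\
  complex.Re (b z) ^+ 2 + complex.Im (b z) ^+ 2 = dist2 a (complex.Re z, complex.Im z) `^ c.
Proof.
move=> /hb.2[_ [l [hl ->]]].
have nexp (w : R[i]) : complex.Re (cexp w) ^+ 2 + complex.Im (cexp w) ^+ 2 = expR (complex.Re w) ^+ 2.
  case: w => x y; rewrite /cexp /=.
  rewrite (_ : _ + _ = expR x ^+ 2 * (cos y ^+ 2 + sin y ^+ 2)); last by ring.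
  by rewrite cos2Dsin2 mulr1.
have -> : dist2 a (complex.Re z, complex.Im z) = expR (complex.Re l) ^+ 2.
  by rewrite -nexp hl; case: z {hl} => x y; rewrite /dist2 /= oppr0 addr0.
split; first by rewrite exprn_gt0// expR_gt0.
rewrite nexp; case: l {hl} => x y /=; rewrite mul0r subr0.
by rewrite -!expRM_natl -expRM; congr expR; ring.
Qed.

Lemma branch_ball z : D z -> exists2 r : R, 0 < r & forall w, `|z - w| < r%:C -> D w.
Proof.
move=> Dz; have /= := open_nbhs_nbhs (conj hb.1 Dz).
move=> /nbhs_ballP[[r1 r2]] /= r0 hr; move: r0; rewrite ltcE /= => /andP[/eqP r20 r10].
exists r1 => // w zw; apply: hr; rewrite /ball /= /ball_ /=.
by rewrite (_ : r1 +i* r2 = r1%:C)// r20.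
Qed.

(** Differentiating |b|^2 = |z - a|^(2c) in x and y gives the real and imaginary
parts of conj(b) b', which together with |b| != 0 determine b'. *)
Lemma branch_deriv z d : D z -> hderiv b z d -> d * (z - a%:C) = c%:C * b z.
Proof.
move=> Dz [[x1 x2] [y1 y2]]; have [s0 nb] := branch_norm Dz.
have [r r0 hr] := branch_ball Dz.
case: z Dz s0 nb hr x1 x2 y1 y2 => x y Dz s0 nb hr /= x1 x2 y1 y2.
have nx : \near x, complex.Re (b (x +i* y)) ^+ 2 + complex.Im (b (x +i* y)) ^+ 2 = dist2 a (x, y) `^ c.
  exists r => //= t; rewrite /ball_ /= => xt; apply: (branch_norm (z := t +i* y) _).2; apply: hr.
  by rewrite normc_def /= subrr expr0n addr0 sqrtr_sqr ltcR.
have ny : \near y, complex.Re (b (x +i* y)) ^+ 2 + complex.Im (b (x +i* y)) ^+ 2 = dist2 a (x, y) `^ c.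
  exists r => //= t; rewrite /ball_ /= => xt; apply: (branch_norm (z := x +i* t) _).2; apply: hr.
  by rewrite normc_def /= subrr expr0n add0r sqrtr_sqr ltcR.
have dx := near_eq_is_derive nx (is_derive1D (is_derive1M x1 x1) (is_derive1M x2 x2)).
have dy := near_eq_is_derive ny (is_derive1D (is_derive1M y1 y1) (is_derive1M y2 y2)).
have sx : is_derive x 1 (fun x : R => dist2 a (x, y)) (2 * (x - a)) := sqr_dist_dx a x y.
have sy : is_derive y 1 (fun y : R => dist2 a (x, y)) (2 * y) := sqr_dist_dy a x y.
have uniq (f : R -> R) t p q : is_derive t 1 f p -> is_derive t 1 f q -> p = q.
  by move=> [_ <-] [_ <-].
have {dx} ex := uniq _ _ _ _ dx (is_derive1_powR' c sx s0).
have {dy} ey := uniq _ _ _ _ dy (is_derive1_powR' c sy s0).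
have ks : dist2 a (x, y) * dist2 a (x, y) `^ (c - 1) = dist2 a (x, y) `^ c.
  rewrite powRB; last by apply/implyP => _; exact: lt0r_neq0.
  by rewrite powRr1 ?(ltW s0)//; field; exact: lt0r_neq0.
move: ex ey; rewrite -{}ks in nb; set k := dist2 a (x, y) `^ (c - 1) in nb *.
have sE : dist2 a (x, y) = (x - a) ^+ 2 + y ^+ 2 by [].
have k0 : 0 < k by exact: powR_gt0.
rewrite sE in nb s0; clearbody k; clear sE sx sy nx ny hr x1 x2 y1 y2.
move: nb; case: (b (x +i* y)) => br bi; case: d => dr di /= nb.
move=> ex ey.
have m0 : br ^+ 2 + bi ^+ 2 != 0 by rewrite nb mulf_neq0 ?gt_eqF.
have e1 : br * dr + bi * di = c * (x - a) * k by lra.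
have e2 : br * di - bi * dr = - (c * y * k) by lra.
apply/eqP; rewrite eq_complex /=; apply/andP; split; apply/eqP; apply: (mulfI m0).
  have -> : (br ^+ 2 + bi ^+ 2) * (dr * (x - a) - di * (y - 0)) =
     (x - a) * (br * (br * dr + bi * di) - bi * (br * di - bi * dr))
     - y * (bi * (br * dr + bi * di) + br * (br * di - bi * dr)) by ring.
  by rewrite e1 e2 nb; ring.
have -> : (br ^+ 2 + bi ^+ 2) * (dr * (y - 0) + di * (x - a)) =
     y * (br * (br * dr + bi * di) - bi * (br * di - bi * dr))
     + (x - a) * (bi * (br * dr + bi * di) + br * (br * di - bi * dr)) by ring.
by rewrite e1 e2 nb; ring.
Qed.

End Branch.

End ComplexDerivatives.

(** * The Christoffel-Darboux formula *)

(** The factors that depend on zeta are constants, and the exponential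
contributes - N zeta. *)
Lemma dbar_kernel_tilde (R : realType) (N n : nat) (P : nat -> {poly R[i]}) (h : nat -> R)
    (b : R[i] -> R[i]) (zeta eta d : R[i]) : hderiv b eta d ->
  dbar (fun w => kernel_tilde N b P h n zeta w) eta =
  cexp (- (N%:R * (zeta * conjc eta))) * \sum_(j < n)
    (conjc ((d * (P j).[eta] + b eta * (P j)^`().[eta]) / (h j)%:C)
     - N%:R * zeta * conjc (phi b P h j eta)) * psi b P j zeta.
Proof.
move=> hb; apply: dbar_aderiv.
have de : aderiv (fun w => - (N%:R * (zeta * conjc w))) eta (- (N%:R * zeta)).
  have := aderivM (aderiv_cst (- (N%:R * zeta)) eta) (aderiv_conj_id eta).
  rewrite mul0r add0r mulr1; congr (aderiv _ _ _); apply/funext => w; ring.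
have dphi j : hderiv (phi b P h j) eta ((d * (P j).[eta] + b eta * (P j)^`().[eta]) / (h j)%:C).
  have h1 := hderivM (hderiv_poly (P j) eta) (hderiv_cst ((h j)%:C)^-1 eta).
  have := hderivM hb h1; rewrite mulr0 addr0 => h2.
  by rewrite mulrDl -!mulrA.
have ds := aderiv_sum (fun j : 'I_n => aderivM (hderiv_conj (dphi j)) (aderiv_cst (psi b P j zeta) eta)).
have := aderivM (aderiv_exp de) ds; congr (aderiv _ _ _).
rewrite -mulrA -mulrDr; congr (_ * _).
rewrite mulr_sumr -big_split /=; apply: eq_bigr => j _; ring.
Qed.

Lemma dbar_conj_psi (R : realType) (P : nat -> {poly R[i]}) j (b : R[i] -> R[i]) (eta d : R[i]) :
  hderiv b eta d ->
  dbar (fun w => conjc (psi b P j w)) eta = conjc (d * (P j).[eta] + b eta * (P j)^`().[eta]).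
Proof. by move=> hb; apply/dbar_aderiv/hderiv_conj/hderivM => //; exact: hderiv_poly. Qed.

Lemma conj_horner_real (R : realType) (q : {poly R}) (z : R[i]) :
  conjc (map_poly (real_complex R) q).[z] = (map_poly (real_complex R) q).[conjc z].
Proof.
elim/poly_ind: q => [|q k IH]; first by rewrite rmorph0 !horner0 conjc0.
rewrite rmorphD rmorphM /= map_polyX map_polyC !hornerMXaddC rmorphD rmorphM /= IH.
by congr (_ + _); exact: conjc_real.
Qed.

(** The passage from the cancelled identity to the stated one.  Here s and r'
carry the inverted denominators, t and t1 are step coefficients and delta is
the conjugated derivative of the branch, so that delta w = C beta is the
conjugate of (z - a) b' = c b. *)
Lemma cd_rearrange (F : fieldType) (E bx k1 k2 q q1 t t1 s r r' w C delta beta y0 y1 y1' : F) :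
  q != 0 -> s * t * q = 1 -> r' * t1 * q1 = r -> delta * w = C * beta ->
  E * (bx * beta * (((w * y1' + C * y1) * k1 - r * w * y0 * k2) / q)) =
  (E * s * (delta * y1 + beta * y1') * (bx * (t * k1))
   - E * (q1 / q) * r' * (beta * y0) * (bx * (t1 * k2))) * w.
Proof.
move=> q0 st <- dw; apply: (mulIf q0).
transitivity (E * bx * k1 * ((C * beta) * y1 + beta * w * y1') * (s * t * q)
  - E * bx * beta * r' * t1 * q1 * w * y0 * k2).
  by rewrite st; field.
by rewrite -dw; field.
Qed.

Theorem theorem1p1 (R : realType) (N n : nat) (a c : R)
    (P : nat -> {poly R[i]}) (h : nat -> R)
    (D : set R[i]^o) (b : R[i] -> R[i]) (zeta eta : R[i])
    (hN : (1 <= N)%N) (hn : (1 <= n)%N)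
    (ha0 : 0 <= a) (ha : a != 0) (hc1 : -1 < c) (hc : c != 0)
    (hP : monic_orthogonal N a c P h)
    (hb : power_branch D a c b)
    (hzeta : D zeta) (heta : D eta) :
  dbar (fun w => kernel_tilde N b P h n zeta w) eta =
    cexp (- (N%:R * (zeta * conjc eta)))
      * (((n%:R + c) / N%:R * h n.-1 - h n)^-1)%:C
      * dbar (fun w => conjc (psi b P n w)) eta
      * (psi b P n zeta - zeta * psi b P n.-1 zeta)
    - cexp (- (N%:R * (zeta * conjc eta)))
      * ((P n.+1).[a%:C] / (P n).[a%:C])
      * (N%:R * (h n / h n.-1) / ((n%:R + c + 1) / N%:R * h n - h n.+1))%:C
      * conjc (psi b P n.-1 eta)
      * (psi b P n.+1 zeta - zeta * psi b P n zeta).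
Proof.
have a_gt0 : 0 < a by rewrite lt_neqAle eq_sym ha.
have N_gt0 : 0 < N%:R :> R by rewrite ltr0n.
pose Q j := rePoly (P j).
have B_lin := realform_linear a hN hc1.
have B_sym := @realform_sym R N a c.
have B_gt0 := fun p => @realform_gt0 R N a c hN hc1 p.
have B_ibp := realform_ibp a hN hc1 hc.
have B_num := realform_number hN a_gt0 hc1 hc.
have PQ j : P j = map_poly (real_complex R) (Q j) by exact: (P_real hN a_gt0 hc1 hc hP).
have Q_monic j : Q j \is monic by have [] := rePoly_monic hN a_gt0 hc1 hc hP j.
have Q_size j : size (Q j) = j.+1 by have [] := rePoly_monic hN a_gt0 hc1 hc hP j.
have Q_orth : forall j k, realform N a c (Q j) (Q k) = if j == k then h j else 0.
  exact: (realform_orth hN a_gt0 hc1 hc hP).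
case: n hn => // n _.
have CD := christoffel_darboux a_gt0 N_gt0 B_lin B_sym B_gt0 B_ibp B_num Q_monic Q_size Q_orth
  (real_complex R) n zeta (conjc eta).
have step_n0 j := step_coef_neq0 a_gt0 N_gt0 B_lin B_sym B_gt0 B_ibp B_num Q_monic Q_size Q_orth j hc.
have val_gt0 j := val_at_gt0 a_gt0 N_gt0 B_lin B_sym B_gt0 B_ibp B_num Q_monic Q_size Q_orth j.
have hS j := h_step N_gt0 B_lin B_sym B_ibp Q_monic Q_size Q_orth j.
have QS j := Q_step N_gt0 B_lin B_sym B_gt0 B_ibp Q_monic Q_size Q_orth j.
have hgt0 j := h_gt0 B_gt0 Q_monic Q_orth j.
have [d hd] := hderiv_derivable (hb.2 _ heta).1.
have hda := branch_deriv hb heta hd.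
have ya0 : conjc eta - a%:C != 0.
  have [s0 _] := branch_norm hb heta; apply/eqP => /subr0_eq e.
  move: s0; rewrite (_ : eta = a%:C) /dist2 /= ?subrr ?expr0n ?addr0 ?ltxx//.
  by rewrite -[eta]conjcK e /= oppr0.
rewrite (dbar_kernel_tilde _ _ _ _ _ hd) (dbar_conj_psi _ _ hd) /=.
rewrite /phi /psi; set x := zeta in CD *; set y := conjc eta in CD ya0 *.
pose X j := (P j).[x]; pose Y j := (P j).[y]; pose Y' j := (P j)^`().[y].
have cP j : conjc (P j).[eta] = Y j by rewrite /Y PQ conj_horner_real.
have cP' j : conjc (P j)^`().[eta] = Y' j by rewrite /Y' PQ deriv_map conj_horner_real.
have PX j : (map_poly (real_complex R) (Q j)).[x] = X j by rewrite /X PQ.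
have PY j : (map_poly (real_complex R) (Q j)).[y] = Y j by rewrite /Y PQ.
have LY j : (map_poly (real_complex R) (euler_op a c (Q j))).[y] = (y - a%:C) * Y' j + c%:C * Y j.
  rewrite /euler_op rmorphD /= map_polyZ rmorphM rmorphB /= map_polyX map_polyC -deriv_map -!PQ.
  by rewrite !hornerE.
have Pa j : (P j).[a%:C] = (val_at a Q j)%:C by rewrite PQ horner_map.
have XS j : X j.+1 - x * X j =
    (step_coef (realform N a c) Q j)%:C * (map_poly (real_complex R) (kernel_at a Q h j.+1)).[x].
  rewrite -2!PX QS rmorphD /= map_polyZ rmorphM /= map_polyX !hornerE.
  by rewrite addrAC subrr add0r.
set beta := conjc (b eta); set delta := conjc d.
have hda' : delta * (y - a%:C) = c%:C * beta.
  have := congr1 (@conjc R) hda; by rewrite !rmorphM rmorphB /= !oppr0.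
have cN (k : R) : k%:C^-1 = (k^-1)%:C by rewrite fmorphV.
have conjM (u v : R[i]) : conjc (u * v) = conjc u * conjc v by rewrite rmorphM.
have conjV (u : R[i]) (k : R) : conjc (u / k%:C) = conjc u / k%:C.
  by rewrite cN conjM; congr (_ * _); exact: conjc_real.
have dY j : conjc (d * (P j).[eta] + b eta * (P j)^`().[eta]) = delta * Y j + beta * Y' j.
  by rewrite rmorphD /= !conjM cP cP'.
have dYh (j : 'I_n.+1) : conjc ((d * (P j).[eta] + b eta * (P j)^`().[eta]) / (h j)%:C) =
    (delta * Y j + beta * Y' j) / (h j)%:C.
  by rewrite conjV dY.
have Yh (j : 'I_n.+1) : conjc (b eta * ((P j).[eta] / (h j)%:C)) = beta * Y j / (h j)%:C.
  by rewrite mulrA conjV conjM cP.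
have sumE : (\sum_(j < n.+1)
     (conjc ((d * (P j).[eta] + b eta * (P j)^`().[eta]) / (h j)%:C) -
      N%:R * x * conjc (b eta * ((P j).[eta] / (h j)%:C))) * (b x * (P j).[x])) * (y - a%:C) =
   (b x * beta) * \sum_(j < n.+1) (h j)%:C^-1 * (map_poly (real_complex R) (Q j)).[x] *
       ((map_poly (real_complex R) (euler_op a c (Q j))).[y] -
        (N%:R)%:C * x * (y - a%:C) * (map_poly (real_complex R) (Q j)).[y]).
  rewrite mulr_suml mulr_sumr; apply: eq_bigr => j _.
  rewrite PX PY LY -/(X j) (dYh j) (Yh j).
  rewrite [(N%:R)%:C]rmorph_nat.
  have -> (p q r : R[i]) : (p / q - r) * (b x * X j) * (y - a%:C) =
      b x * X j * (p * (y - a%:C) / q - r * (y - a%:C)).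
    by ring.
  have -> : (delta * Y j + beta * Y' j) * (y - a%:C) = beta * (c%:C * Y j + (y - a%:C) * Y' j).
    by rewrite mulrDl [delta * _ * _]mulrAC hda'; ring.
  by ring.
rewrite !dY ?conjM ?cP -!/(X _) !Pa -/beta.
rewrite (_ : n.+1%:R + c + 1 = n.+2%:R + c); last by rewrite -[n.+2%:R]natr1; ring.
have dS j : (j.+1%:R + c) / N%:R * h j - h j.+1 = val_at a Q j.+1 * step_coef (realform N a c) Q j.
  by rewrite hS; ring.
have sX j : b x * X j.+1 - x * (b x * X j) =
    b x * ((step_coef (realform N a c) Q j)%:C * (map_poly (real_complex R) (kernel_at a Q h j.+1)).[x]).
  by rewrite -XS; ring.
(* After multiplication by conj(eta) - a, the conjugated derivative of the branch
   becomes c times the conjugated branch. *)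
rewrite !dS !sX; apply: (mulIf ya0).
rewrite -[LHS]mulrA.
apply: (etrans (congr1 (fun v => cexp (- (N%:R * (x * y))) * v)
  (etrans sumE (congr1 (fun v => b x * beta * v) CD)))).
rewrite PY LY.
move: (step_n0 n) (step_n0 n.+1) (val_gt0 n.+1) (val_gt0 n.+2) (hgt0 n) (hgt0 n.+1).
move: (step_coef _ _ n) (step_coef _ _ n.+1) (val_at _ _ n.+1) (val_at _ _ n.+2) (h n) (h n.+1).
move=> t t1 q q1 h0 h1 t_n0 t1_n0 q_gt0 q1_gt0 h0_gt0 h1_gt0.
have q0 : q%:C != 0 by rewrite fmorph_eq0 gt_eqF.
have sqt : ((q * t)^-1)%:C * t%:C * q%:C = 1.
  by rewrite -!rmorphM -[RHS](rmorph1 (real_complex R)); congr _%:C; field; rewrite t_n0 gt_eqF.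
have rqt : (N%:R * (h1 / h0) / (q1 * t1))%:C * t1%:C * q1%:C = (N%:R * (h1 / h0))%:C.
  by rewrite -!rmorphM; congr _%:C; field; rewrite t1_n0 !gt_eqF.
have := (@cd_rearrange _ (cexp (- (N%:R * (x * y)))) (b x)
  (map_poly (real_complex R) (kernel_at a Q h n.+1)).[x]
  (map_poly (real_complex R) (kernel_at a Q h n.+2)).[x]
  _ _ _ _ _ _ _ _ _ _ _ (Y n) (Y n.+1) (Y' n.+1) q0 sqt rqt hda').
exact.
Qed.
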